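(* Let $G$ be a locally nilpotent group that is not an abelian group of rank $\le 1$. If $G$ is countable and torsion-free, then the space $\mathrm{BiO}(G)$ of bi-invariant orders on $G$ is homeomorphic to the Cantor set.
   Context: A total order $\prec$ on the elements of a group $G$ is left-invariant if $x \prec y \Rightarrow gx \prec gy$ for all $x,y,g \in G$, and bi-invariant if moreover $x \prec y \Rightarrow xg \prec yg$ for all $x,y,g\in G$. $\mathrm{LO}(G)$ is the set of all left-invariant (strict total) orders on $G$, with the topology generated by the basic open sets $\{\, {\prec} \in \mathrm{LO}(G) \mid x \prec y \,\}$ for $x,y \in G$ (i.e. these sets form a subbasis). $\mathrm{BiO}(G)$ is the subset of bi-invariant orders, with the subspace topology. The rank of an abelian group $A$ is its torsion-free rank $\dim_{\mathbb{Q}}(A \otimes \mathbb{Q})$. A group is locally nilpotent if each of its finitely generated subgroups is nilpotent. *)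

(* Defs.v *)
From HB Require Import structures.
From mathcomp Require Import all_boot all_order all_algebra.
From mathcomp Require Import all_classical topology cantor.
From mathcomp Require Import freeg.

Set Implicit Arguments.
Unset Strict Implicit.
Unset Printing Implicit Defensive.

Import Order.TTheory GRing.Theory Num.Theory.

Local Open Scope classical_set_scope.
Local Open Scope quotient_scope.
Local Open Scope group_scope.

Definition subgroup_generated (G : groupType) (X : set G) : set G :=
  smallest [set H : set G | group_closed (mem H)] X.

Definition commutator_subgroup (G : groupType) (H K : set G) : set G :=
  subgroup_generated [set z | exists x y, [/\ H x, K y & z = [~ x, y]]].

Fixpoint lower_central (G : groupType) (H : set G) (n : nat) : set G :=
  if n is n'.+1 then commutator_subgroup (lower_central H n') H else H.

Definition nilpotent_subgroup (G : groupType) (H : set G) : Prop :=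
  exists n, lower_central H n = [set 1].

Definition locally_nilpotent (G : groupType) : Prop :=
  forall X : set G, finite_set X -> nilpotent_subgroup (subgroup_generated X).

Definition torsion_free (G : groupType) : Prop :=
  forall (x : G) (n : nat), (0 < n)%N -> x ^+ n = 1 -> x = 1.

Definition abelian_group (G : groupType) : Prop :=
  forall x y : G, x * y = y * x.

(* An abelian group written additively, so that the library's Z-modules
   apply. *)
Definition zmod_of (G : groupType) (abG : abelian_group G) : Type := G.

Section ZmodOf.
Variables (G : groupType) (abG : abelian_group G).
Local Notation A := (zmod_of abG).

HB.instance Definition _ := Choice.on A.

Let add (x y : A) : A := (x : G) * (y : G).
Let opp (x : A) : A := (x : G)^-1.

Let addA : associative add. Proof. exact: mulgA. Qed.
Let addC : commutative add. Proof. exact: abG. Qed.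
Let add0 : left_id (1 : G) add. Proof. exact: mul1g. Qed.
Let addN : left_inverse (1 : G) opp add. Proof. exact: mulVg. Qed.

HB.instance Definition _ := GRing.isZmodule.Build A addA addC add0 addN.

End ZmodOf.

Local Open Scope ring_scope.

Section Tensor.
Variables A B : zmodType.
Local Notation F := {freeg (A * B)%type}.

Definition bilinear_relators : set F :=
  [set r |
     (exists a a' b, r = << (a + a', b) >> - << (a, b) >> - << (a', b) >>) \/
     (exists a b b', r = << (a, b + b') >> - << (a, b) >> - << (a, b') >>)].

Definition bilinear_subgroup : set F :=
  smallest [set S : set F | zmod_closed (mem S)] bilinear_relators.

Definition bilinear_pred : {pred F} := mem bilinear_subgroup.

Lemma bilinear_pred_zmod_closed : zmod_closed bilinear_pred.
Proof.
split; first by apply/mem_set => S [[S0 _] _]; exact/set_mem.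
move=> u v /set_mem uS /set_mem vS; apply/mem_set => S S'.
by case: (S') => -[_ SB] _; apply/set_mem/SB; apply/mem_set; [exact: uS|exact: vS].
Qed.

HB.instance Definition _ :=
  GRing.isZmodClosed.Build F bilinear_pred bilinear_pred_zmod_closed.

(* The tensor product of A and B over Z: the free abelian group on A * B modulo
   the subgroup generated by the bilinearity relators. *)
Definition tensor : Type := Quotient.quot bilinear_pred.

HB.instance Definition _ := GRing.Zmodule.on tensor.

Definition tensor_pi (u : F) : tensor := \pi_(Quotient.quot bilinear_pred) u.

Definition pure_tensor (a : A) (b : B) : tensor := tensor_pi << (a, b) >>.

Lemma tensor_pi_zmod_morphism : zmod_morphism tensor_pi.
Proof. by move=> u v; rewrite /tensor_pi !piE. Qed.

HB.instance Definition _ :=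
  GRing.isZmodMorphism.Build F tensor tensor_pi tensor_pi_zmod_morphism.

Lemma tensor_pi_eq u v :
  (tensor_pi u = tensor_pi v) <-> bilinear_subgroup (u - v).
Proof.
rewrite -[bilinear_subgroup _]in_setE; split.
  by move=> /eqP; rewrite -Quotient.idealrBE.
by move=> h; apply/eqP; rewrite -Quotient.idealrBE.
Qed.

Lemma tensor_pi_surj t : exists u, t = tensor_pi u.
Proof. by exists (repr t); rewrite /tensor_pi reprK. Qed.

Lemma pure_tensorDl a a' b :
  pure_tensor (a + a') b = pure_tensor a b + pure_tensor a' b.
Proof.
apply/eqP; rewrite -subr_eq0 opprD addrA -!raddfB; apply/eqP.
rewrite -(raddf0 tensor_pi); apply/tensor_pi_eq; rewrite subr0.
by apply: sub_gen_smallest; left; exists a, a', b.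
Qed.

Lemma pure_tensorDr a b b' :
  pure_tensor a (b + b') = pure_tensor a b + pure_tensor a b'.
Proof.
apply/eqP; rewrite -subr_eq0 opprD addrA -!raddfB; apply/eqP.
rewrite -(raddf0 tensor_pi); apply/tensor_pi_eq; rewrite subr0.
by apply: sub_gen_smallest; right; exists a, b, b'.
Qed.

Lemma tensor_ind (P : tensor -> Prop) :
    P 0 -> (forall s t, P s -> P t -> P (s - t)) ->
    (forall a b, P (pure_tensor a b)) ->
  forall t, P t.
Proof.
move=> P0 PB Ppure t.
have PN s : P s -> P (- s) by rewrite -(sub0r s); exact: PB.
have PD s s' : P s -> P s' -> P (s + s').
  by move=> Ps Ps'; rewrite -(opprK s'); exact/PB/PN.
have [u ->] := tensor_pi_surj t.
elim/freeg_ind_dom0: u => [|k [a b] u _ _ Pu]; first by rewrite raddf0.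
rewrite raddfD; apply: (PD) => //; rewrite -[k in << k *g _ >>]intz -freegU_mulz raddfMz.
have Pn n : P (pure_tensor a b *+ n).
  by elim: n => [|n IHn] //; rewrite mulrS; apply: PD.
by case: k => n; [exact: Pn|rewrite NegzE mulrNz; exact/PN/Pn].
Qed.

End Tensor.

(* A (x) Q is a vector space over Q through the right factor. *)
Section TensorRat.
Variable A : zmodType.
Local Notation F := {freeg (A * rat)%type}.
Implicit Types (a : A) (b c : rat) (u v : F) (s t : tensor A rat).

Definition freeg_scale c u : F :=
  fglift (fun k : A * rat => << (k.1, c * k.2) >> : F) u.

Definition tensor_scale c t : tensor A rat := tensor_pi (freeg_scale c (repr t)).

Let freeg_scale_is_zmod_morphism c : zmod_morphism (freeg_scale c).
Proof. exact: lift_is_additive. Qed.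

HB.instance Definition _ c :=
  GRing.isZmodMorphism.Build F F (freeg_scale c) (freeg_scale_is_zmod_morphism c).

Let freeg_scaleU c a b : freeg_scale c << (a, b) >> = << (a, c * b) >>.
Proof. by rewrite /freeg_scale liftU scale1r. Qed.

Let freeg_scale_bilinear c u :
  bilinear_subgroup u -> bilinear_subgroup (freeg_scale c u).
Proof.
apply: (@smallest_sub _ _ _ [set u | bilinear_subgroup (freeg_scale c u)]).
  have [B0 BB] := bilinear_pred_zmod_closed A rat.
  split=> [|x y /set_mem /= xS /set_mem /= yS]; apply/mem_set => /=.
    by rewrite raddf0; apply/set_mem.
  by rewrite raddfB; apply/set_mem/BB; apply/mem_set.
move=> r [] [a [b [d ->]]] /=; rewrite !raddfB/= !freeg_scaleU;
  apply: sub_gen_smallest; [left|right; rewrite mulrDr].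
- by exists a, b, (c * d).
- by exists a, (c * b), (c * d).
Qed.

Let tensor_scale_pi c u : tensor_scale c (tensor_pi u) = tensor_pi (freeg_scale c u).
Proof.
apply/tensor_pi_eq; rewrite -raddfB; apply: freeg_scale_bilinear.
by apply/tensor_pi_eq; rewrite /tensor_pi reprK.
Qed.

Let tensor_scale_is_zmod_morphism c : zmod_morphism (tensor_scale c).
Proof.
move=> s t; have [u ->] := tensor_pi_surj s; have [v ->] := tensor_pi_surj t.
by rewrite -raddfB !tensor_scale_pi !raddfB.
Qed.

HB.instance Definition _ c :=
  GRing.isZmodMorphism.Build (tensor A rat) (tensor A rat) (tensor_scale c)
    (tensor_scale_is_zmod_morphism c).

Lemma tensor_scale_pure c a b :
  tensor_scale c (pure_tensor a b) = pure_tensor a (c * b).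
Proof. by rewrite tensor_scale_pi freeg_scaleU. Qed.

Let tensor_scaleA c d t : tensor_scale c (tensor_scale d t) = tensor_scale (c * d) t.
Proof.
elim/tensor_ind: t => [|s t IHs IHt|a b]; first by rewrite !raddf0.
  by rewrite !raddfB/= IHs IHt.
by rewrite !tensor_scale_pure mulrA.
Qed.

Let tensor_scale1 : left_id 1 tensor_scale.
Proof.
move=> t; elim/tensor_ind: t => [|s t IHs IHt|a b]; first by rewrite !raddf0.
  by rewrite !raddfB/= IHs IHt.
by rewrite !tensor_scale_pure mul1r.
Qed.

Let tensor_scaleDr : right_distributive tensor_scale +%R.
Proof. by move=> c s t; rewrite raddfD. Qed.

Let tensor_scaleDl t : {morph tensor_scale^~ t : c d / c + d}.
Proof.
move=> c d; elim/tensor_ind: t => [|s t IHs IHt|a b].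
- by rewrite !raddf0 addr0.
- by rewrite !raddfB/= IHs IHt opprD addrACA.
- by rewrite !tensor_scale_pure mulrDl pure_tensorDr.
Qed.

HB.instance Definition _ :=
  GRing.Zmodule_isLmodule.Build rat (tensor A rat)
    tensor_scaleA tensor_scale1 tensor_scaleDr tensor_scaleDl.

Lemma scale_pure_tensor c a b : c *: pure_tensor a b = pure_tensor a (c * b).
Proof. exact: tensor_scale_pure. Qed.

End TensorRat.

Definition has_dimension (K : fieldType) (V : lmodType K) (n : nat) : Prop :=
  exists e : 'I_n -> V,
    (forall c : 'I_n -> K, \sum_(i < n) c i *: e i = 0 -> forall i, c i = 0) /\
    (forall v : V, exists c : 'I_n -> K, v = \sum_(i < n) c i *: e i).

Definition rank_le (A : zmodType) (n : nat) : Prop :=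
  exists2 m, (m <= n)%N & has_dimension (tensor A rat) m.

Local Close Scope ring_scope.

Record left_order (G : groupType) := LeftOrder {
  lo_lt :> G -> G -> Prop;
  lo_irr : forall x, ~ lo_lt x x;
  lo_trans : forall x y z, lo_lt x y -> lo_lt y z -> lo_lt x z;
  lo_total : forall x y, x <> y -> lo_lt x y \/ lo_lt y x;
  lo_left : forall x y g, lo_lt x y -> lo_lt (g * x) (g * y)
}.

Section LeftOrderTopology.
Variable G : groupType.

HB.instance Definition _ := gen_eqMixin (left_order G).
HB.instance Definition _ := gen_choiceMixin (left_order G).

Definition lo_subbase : set (set (left_order G)) :=
  [set U | exists x y : G, U = [set P : left_order G | P x y]].

HB.instance Definition _ :=
  isSubBaseTopological.Build (left_order G) lo_subbase id.

End LeftOrderTopology.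

(* Used below as a type, [BiO G] carries the topology induced from
   [left_order G]. *)
Definition BiO (G : groupType) : set (left_order G) :=
  [set P : left_order G | forall x y g : G, P x y -> P (x * g) (y * g)].
Arguments BiO : clear implicits.

Definition homeomorphic (X Y : topologicalType) : Prop :=
  exists (f : X -> Y) (g : Y -> X),
    [/\ cancel f g, cancel g f, continuous f & continuous g].

(* Main.v *)
Require Import Defs.
From HB Require Import structures.
From mathcomp Require Import all_boot all_order all_algebra.
From mathcomp Require Import all_classical topology cantor.

(** A bi-order is the same thing as its positive cone, and the space of bi-orders
    of a countable group is compact, Hausdorff and has countably many clopen sets
    separating its points (the sets of orders in which a given element is
    positive). Such a space is homeomorphic to the Cantor set as soon as it is
    nonempty and has no isolated point ([cantor_homeomorphic]). Both conditions
    rest on one property of orders on locally nilpotent groups: commutators are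
    infinitely smaller than their entries, that is, every power of [[~ x, g]] lies
    between [x^-1] and [x] when [x] is positive. In a nilpotent group it follows
    by descending induction along the lower central series: as
    [x ^ g = x * [~ x, g]], conjugating [x] repeatedly by [g] or [g^-1] moves it
    down by about one commutator each time, and [x] must remain positive.

    Nonemptiness is the case of the empty cone in [total_cone_extension]: every
    cone of a torsion-free locally nilpotent group extends to a total one. Take a
    maximal cone. If [x] were incomparable to [1], there would be products [u] and
    [v] of conjugates of [x] with [u <= 1 <= v]; inside the nilpotent subgroup
    generated by the finitely many elements involved, the smallness of commutators
    shows that this cannot happen ([nilpotent_maximal_cone_total]).

    For the absence of isolated points, suppose that a total order is determined
    by the positivity of finitely many elements, forming a list [L]. If [E] and
    [F] are normal convex subgroups with [E] strictly contained in [F], reversing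
    the order between [E] and [F] gives another order, so some element of [L] lies
    in [F] but not in [E]. Hence the whole group is the convex hull of the largest
    element [g] of [L]. The elements infinitely smaller than [g] form a normal
    convex subgroup, and the quotient by it is abelian. An order on an abelian
    quotient which is determined by [L] has, up to taking roots, a finitely
    generated cone; of two generators the larger one is redundant, as a multiple
    of the difference is a combination of all of them, so the quotient has rank
    one ([determined_commensurable]). If the elements infinitely smaller than [g]
    were not all trivial, the same argument one step further down would give an
    abelian quotient of rank one with a nontrivial proper convex subgroup, which
    is absurd. So the group itself would be abelian of rank at most one
    ([determined_rank_one]). *)

Set Implicit Arguments.
Unset Strict Implicit.
Unset Printing Implicit Defensive.

Import Order.TTheory GRing.Theory Num.Theory.

Local Open Scope classical_set_scope.
Local Open Scope group_scope.

(** * Reduction of group words *)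

Lemma mulgAr (G : groupType) (x y z : G) : (x * y) * z = x * (y * z).
Proof. by rewrite mulgA. Qed.

(** Brings group words to their freely reduced, right-associated form, which
    decides equalities between them. *)
Ltac gword :=
  rewrite ?(commgEl, conjgE, invgM, invgK, invg1, mulgAr, mulg1, mul1g, mulVg,
            mulgV, mulKg, mulVKg) //.

(** * Partial bi-orders as cones *)

Definition subgrp (G : groupType) (H : set G) : Prop :=
  [/\ H 1, forall x y, H x -> H y -> H (x * y) & forall x, H x -> H x^-1].

Definition normal_subgrp (G : groupType) (H : set G) : Prop :=
  subgrp H /\ forall x g, H x -> H (x ^ g).

Definition cone (G : groupType) (P : set G) : Prop :=
  [/\ ~ P 1, forall x y, P x -> P y -> P (x * y) &
      forall x g, P x -> P (x ^ g)].

Definition cone_le (G : groupType) (P : set G) (x y : G) : Prop :=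
  x = y \/ P (x^-1 * y).

Section SubgroupTheory.
Variables (G : groupType) (H : set G).

Lemma subgrpX : subgrp H -> forall x n, H x -> H (x ^+ n).
Proof. by case=> H1 HM _ x n Hx; elim: n => // n IH; rewrite expgS; apply: HM. Qed.

Lemma subgrp_mull : subgrp H -> forall x y, H x -> H (x * y) -> H y.
Proof. by case=> H1 HM HV x y /HV Hx /(HM _ _ Hx); rewrite mulKg. Qed.

Lemma subgrp_mulr : subgrp H -> forall x y, H y -> H (x * y) -> H x.
Proof. by case=> H1 HM HV x y /HV Hy /HM /(_ Hy); rewrite mulgK. Qed.

End SubgroupTheory.

Section ConeOrder.
Variables (G : groupType) (P : set G).
Hypothesis coneP : cone P.

Local Notation "x ⪯ y" := (cone_le P x y) (at level 70).

Let PM x y : P x -> P y -> P (x * y). Proof. by case: coneP => _ + _; apply. Qed.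
Let PJ x g : P x -> P (x ^ g). Proof. by case: coneP => _ _; apply. Qed.

Lemma cone_leE x y : x ⪯ y <-> 1 ⪯ x^-1 * y.
Proof.
split=> -[]; rewrite /cone_le; last by rewrite invg1 mul1g; right.
- by move->; left; rewrite mulVg.
- by right; rewrite invg1 mul1g.
- by move=> /esym/eqP; rewrite mulg_eq1 => /eqP/invg_inj->; left.
Qed.

Lemma cone_le1 x : 1 ⪯ x <-> (x = 1 \/ P x).
Proof. by rewrite /cone_le invg1 mul1g; split=> -[]; [left|right|left|right]. Qed.

Lemma cone_le_refl x : x ⪯ x. Proof. by left. Qed.

Lemma cone_ge1M x y : 1 ⪯ x -> 1 ⪯ y -> 1 ⪯ x * y.
Proof.
move=> /cone_le1[->|Px] /cone_le1[->|Py]; rewrite ?mulg1 ?mul1g cone_le1.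
- by left.
- by right.
- by right.
- by right; apply: PM.
Qed.

Lemma cone_le_trans y x z : x ⪯ y -> y ⪯ z -> x ⪯ z.
Proof.
rewrite (cone_leE x) (cone_leE y) (cone_leE x z) => xy yz.
by have := cone_ge1M xy yz; gword.
Qed.

Lemma cone_le_anti x y : x ⪯ y -> y ⪯ x -> x = y.
Proof.
case=> // Pxy [// | Pyx]; case: coneP => P1 _ _; exfalso; apply: P1.
by have := PM Pxy Pyx; gword.
Qed.

Lemma cone_leMl g x y : x ⪯ y -> g * x ⪯ g * y.
Proof. by case=> [->|Pxy]; [left | right; move: Pxy; gword]. Qed.

Lemma cone_leMr g x y : x ⪯ y -> x * g ⪯ y * g.
Proof. by case=> [->|/(PJ g) Pxy]; [left | right; move: Pxy; gword]. Qed.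

Lemma cone_leM x y z t : x ⪯ y -> z ⪯ t -> x * z ⪯ y * t.
Proof. by move=> /(cone_leMr z) xy /(cone_leMl y); apply: cone_le_trans. Qed.

Lemma cone_leJ g x y : x ⪯ y -> x ^ g ⪯ y ^ g.
Proof. by case=> [->|/(PJ g) Pxy]; [left | right; move: Pxy; gword]. Qed.

Lemma cone_leV x y : x ⪯ y -> y^-1 ⪯ x^-1.
Proof.
by move=> /(cone_leMl x^-1)/(cone_leMr y^-1); rewrite mulVg mul1g mulgK.
Qed.

Lemma cone_leV1 x : 1 ⪯ x -> x^-1 ⪯ 1.
Proof. by move=> /cone_leV; rewrite invg1. Qed.

Lemma cone_le1V x : x ⪯ 1 -> 1 ⪯ x^-1.
Proof. by move=> /cone_leV; rewrite invg1. Qed.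

Lemma cone_leX n x y : x ⪯ y -> x ^+ n ⪯ y ^+ n.
Proof.
move=> xy; elim: n => [|n IH]; first exact: cone_le_refl.
by rewrite !expgS; apply: cone_leM.
Qed.

Lemma cone_ge1X n x : 1 ⪯ x -> 1 ⪯ x ^+ n.
Proof. by move=> /(cone_leX n); rewrite expg1n. Qed.

Lemma cone_leXn m n x : 1 ⪯ x -> (m <= n)%N -> x ^+ m ⪯ x ^+ n.
Proof.
move=> x1 /subnKC <-; rewrite expgnDr -{1}[x ^+ m]mulg1.
exact/cone_leMl/cone_ge1X.
Qed.

Lemma cone_le_X n x : (0 < n)%N -> 1 ⪯ x -> x ⪯ x ^+ n.
Proof. by move=> n0 x1; rewrite -{1}[x]expg1; apply: cone_leXn. Qed.

Lemma cone_ge1J g x : 1 ⪯ x -> 1 ⪯ x ^ g.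
Proof. by move=> /(cone_leJ g); rewrite conj1g. Qed.

Lemma cone_leJ1 g x : x ⪯ 1 -> x ^ g ⪯ 1.
Proof. by move=> /(cone_leJ g); rewrite conj1g. Qed.

Lemma cone_le_mul1 x y : 1 ⪯ y -> x ⪯ x * y.
Proof. by move=> /(cone_leMl x); rewrite mulg1. Qed.

Lemma cone_le_mull1 x y : 1 ⪯ y -> x ⪯ y * x.
Proof. by move=> /(cone_leMr x); rewrite mul1g. Qed.

(** If [x ^ h = x * y] with [1 <= y], each of the [n] factors of [(x * y) ^+ n]
    contributes a conjugate of [y], which is at least [1]. *)
Lemma commgX_ge x h n : (0 < n)%N -> 1 ⪯ [~ x, h] -> [~ x, h] ⪯ [~ x ^+ n, h].
Proof.
move=> n0 y1; rewrite (commgEl (x ^+ n)) conjXg.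
have -> : x ^ h = x * [~ x, h] by gword.
case: n n0 => // n _; set y := [~ x, h] in y1 *.
apply: (@cone_le_trans (x ^- n.+1 * (x ^+ n * (x * y)))).
  by rewrite (mulgA (x ^+ n)) -expgSr mulKg; apply: cone_le_refl.
apply: cone_leMl; rewrite expgSr; apply/cone_leMr/cone_leX.
exact: cone_le_mul1.
Qed.

Lemma commgX_le x h n : (0 < n)%N -> [~ x, h] ⪯ 1 -> [~ x ^+ n, h] ⪯ [~ x, h].
Proof.
move=> n0 y1; rewrite (commgEl (x ^+ n)) conjXg.
have -> : x ^ h = x * [~ x, h] by gword.
case: n n0 => // n _; set y := [~ x, h] in y1 *.
apply: (@cone_le_trans (x ^- n.+1 * (x ^+ n * (x * y)))); last first.
  by rewrite (mulgA (x ^+ n)) -expgSr mulKg; apply: cone_le_refl.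
apply: cone_leMl; rewrite expgSr; apply/cone_leMr/cone_leX.
by rewrite -{2}[x]mulg1; apply: cone_leMl.
Qed.

End ConeOrder.

(** * Infinitesimals and small commutators *)

Definition comparable1 (G : groupType) (P : set G) (x : G) : Prop :=
  cone_le P 1 x \/ cone_le P x 1.

(** [H] is a subgroup on which the order is already known to be total; [P] itself
    may be partial. *)
Definition infinitesimal (G : groupType) (P : set G) (H : set G) (w : G) : set G :=
  [set a | H a /\ forall n, cone_le P (a ^+ n) w /\ cone_le P (a^-1 ^+ n) w].

Definition small_commutators (G : groupType) (P H : set G) : Prop :=
  forall x g, H x -> cone_le P 1 x -> infinitesimal P H x [~ x, g].

Section Infinitesimals.
Variables (G : groupType) (P H : set G).
Hypotheses (coneP : cone P) (nH : normal_subgrp H).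
Hypothesis cmpH : forall x, H x -> comparable1 P x.

Local Notation "x ⪯ y" := (cone_le P x y) (at level 70).
Local Notation infin := (infinitesimal P H).

Let gH : subgrp H. Proof. by case: nH. Qed.
Let H1 : H 1. Proof. by case: gH. Qed.
Let HM x y : H x -> H y -> H (x * y). Proof. by case: gH => _ + _; apply. Qed.
Let HV x : H x -> H x^-1. Proof. by case: gH => _ _; apply. Qed.
Let HJ x g : H x -> H (x ^ g). Proof. by case: nH => _; apply. Qed.

Lemma cone_total x y : H x -> H y -> x ⪯ y \/ y ⪯ x.
Proof.
move=> Hx Hy; case: (cmpH (HM (HV Hx) Hy)) => [/(iffRL (cone_leE _ _ _))|]; first by left.
by move=> /(cone_leV coneP); rewrite invg1 invgM invgK => /(iffRL (cone_leE _ _ _)); right.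
Qed.

Lemma infinitesimalV w a : infin w a -> infin w a^-1.
Proof.
case=> Ha inf; split; first exact: HV.
by move=> n; rewrite invgK; case: (inf n).
Qed.

Lemma infinitesimal_max w a b :
    infin w a -> infin w b ->
  exists2 e, infin w e & [/\ 1 ⪯ e, a ⪯ e, a^-1 ⪯ e, b ⪯ e & b^-1 ⪯ e].
Proof.
have abs x : infin w x -> exists2 e, infin w e & [/\ 1 ⪯ e, x ⪯ e & x^-1 ⪯ e].
  move=> ix; case: (cmpH (proj1 ix)) => x1; [exists x | exists x^-1] => //.
  - split=> //; first exact: cone_le_refl.
    by apply: (cone_le_trans coneP _ x1); apply: cone_leV1.
  - exact: infinitesimalV.
  - split; [exact: cone_le1V | | exact: cone_le_refl].
    by apply: (cone_le_trans coneP x1); apply: cone_le1V.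
move=> /abs[e ie [e1 ae aVe]] /abs[f i_f [f1 bf bVf]].
have tr := cone_le_trans coneP.
case: (cone_total (proj1 ie) (proj1 i_f)) => ef; [exists f | exists e] => //.
  by split=> //; [apply: tr ef | apply: tr ef].
by split=> //; [apply: tr ef | apply: tr ef].
Qed.

Lemma infinitesimalM w a b : infin w a -> infin w b -> infin w (a * b).
Proof.
move=> ia ib; split; first exact: (HM (proj1 ia) (proj1 ib)).
have [e [_ ie] [e1 ae aVe be bVe]] := infinitesimal_max ia ib.
have bound x : x ⪯ e * e -> forall n, x ^+ n ⪯ w.
  move=> xe n; apply: (cone_le_trans coneP _ (proj1 (ie (2 * n)%N))).
  by rewrite expgnA expg2; apply: cone_leX.
by move=> n; split; apply: bound; rewrite ?invgM; apply: cone_leM.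
Qed.

(** Since [w <= x] and [x ^+ m.+1 <= w ^+ m] force [w <= 1]. *)
Lemma infinitesimal_root w m a : H w -> 1 ⪯ w -> infin (w ^+ m) a -> infin w a.
Proof.
move=> Hw w1 [Ha ia]; split=> //.
have bound x : H x -> (forall n, x ^+ n ⪯ w ^+ m) -> forall n, x ^+ n ⪯ w.
  move=> Hx xw n; case: (cone_total (subgrpX gH n Hx) Hw) => // wx.
  suff w1E : w = 1 by have := xw n; rewrite w1E !expg1n.
  apply: (cone_le_anti coneP _ w1).
  have := cone_le_trans coneP (cone_leX coneP m.+1 wx).
  rewrite -expgnA => /(_ _ (xw _)) /(cone_leMl (w ^- m)).
  by rewrite mulVg (expgSr w m) mulKg.
move=> n; split; apply: bound.
- exact: Ha.
- by move=> k; case: (ia k).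
- exact: HV.
- by move=> k; case: (ia k).
Qed.

Section Small.
Hypothesis small : small_commutators P H.

Lemma small_conj_le2 x g : H x -> 1 ⪯ x -> x ^ g ⪯ x * x.
Proof.
move=> Hx x1; have [_ /(_ 1%N)[c _]] := small g Hx x1.
have -> : x ^ g = x * [~ x, g] by gword.
exact: cone_leMl.
Qed.

Lemma infinitesimalJ w a g : infin w a -> infin w (a ^ g).
Proof.
have pos x : 1 ⪯ x -> infin w x -> infin w (x ^ g).
  move=> x1 [Hx ix]; split; first exact: HJ.
  move=> n; split.
    apply: (cone_le_trans coneP _ (proj1 (ix (2 * n)%N))).
    by rewrite expgnA expg2; apply/cone_leX/small_conj_le2.
  apply: (@cone_le_trans _ _ coneP 1); last by case: (ix 0%N).
  rewrite -(expg1n _ n) -conjVg; apply/cone_leX/cone_leJ1/cone_leV1 => //.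
move=> ia; case: (cmpH (proj1 ia)) => a1; first exact: pos.
rewrite -[a]invgK conjVg; apply/infinitesimalV/pos; first exact: cone_le1V.
exact: infinitesimalV.
Qed.

Lemma infinitesimal_normal w : 1 ⪯ w -> normal_subgrp (infin w).
Proof.
move=> w1; split; last by move=> x g; apply: infinitesimalJ.
split; [|exact: infinitesimalM|exact: infinitesimalV].
by split=> // n; rewrite invg1 expg1n.
Qed.

(** Each of [y ^ g] and [y ^ g'] is [y] up to an infinitesimal factor, so it is
    at least a square root of [y]. *)
Lemma small_conj_mul_ge y g g' : H y -> 1 ⪯ y -> y ⪯ y ^ g * y ^ g'.
Proof.
move=> Hy y1; have icg := small g Hy y1; have icg' := small g' Hy y1.
have [e [_ ie] [e1 _ ce _ c'e]] := infinitesimal_max icg icg'.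
have -> : y ^ g * y ^ g' = y * ([~ y, g] * y * [~ y, g']) by gword.
apply: cone_le_mul1 => //.
have -> : 1 = [~ y, g] * ([~ y, g]^-1 * [~ y, g']^-1) * [~ y, g'] by gword.
apply/cone_leMr => //; apply/cone_leMl => //.
apply: (cone_le_trans coneP _ (proj1 (ie 2))); rewrite expg2; exact: cone_leM.
Qed.

Lemma small_conj_mul_le y g g' : H y -> y ⪯ 1 -> y ^ g * y ^ g' ⪯ y.
Proof.
move=> Hy y1; have := small_conj_mul_ge g' g (HV Hy) (cone_le1V coneP y1).
by move=> /(cone_leV coneP); rewrite invgK invgM !conjVg !invgK.
Qed.

(** Two conjugations of [z] by [h] multiply it by [y * y ^ h], where [y] is
    [[~ z, h]], and this product is at most [y]. *)
Lemma conj_drift z h m :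
    H [~ z, h] -> [~ z, h] ⪯ 1 -> z ^ (h ^+ (2 * m)) ⪯ z * [~ z, h] ^+ m.
Proof.
set y := [~ z, h] => Hy y1; elim: m => [|m IH].
  by rewrite conjg1 mulg1; apply: cone_le_refl.
set k := h ^+ (2 * m) in IH.
have -> : z ^ (h ^+ (2 * m.+1)) = z ^ k * (y ^ k * y ^ (h * k)).
  rewrite mulnS expgnDr -/k expg2 !conjgM -!conjMg; congr (_ ^ _).
  by rewrite /y; gword.
rewrite expgSr (mulgA z); apply: cone_leM => //.
exact: small_conj_mul_le.
Qed.

(** Otherwise repeated conjugation of [z] by [h], or by [h^-1] if [[~ z, h]] is
    positive, would bring it below [w ^- 2]. *)
Lemma commg_bound w z h :
    1 ⪯ w -> (forall g, H [~ z, g]) -> z ⪯ w ->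
    (forall g, w ^- 2 ⪯ z ^ g) ->
  infin (w ^+ 3) [~ z, h].
Proof.
move=> w1 Hz zw zJ; split=> // n; have w31 : 1 ⪯ w ^+ 3 by apply: cone_ge1X.
have neg g m : [~ z, g] ⪯ 1 -> [~ z, g]^-1 ^+ m ⪯ w ^+ 3.
  move=> y1; have := cone_le_trans coneP (zJ _) (conj_drift m (Hz g) y1).
  move=> /(cone_le_trans coneP) /(_ (cone_leMr coneP _ zw)).
  move=> /(cone_leMl (w ^+ 2)) /(cone_leMr coneP ([~ z, g] ^- m)).
  by rewrite mulgV mul1g mulgA -expgSr mulgK expVgn.
case: (cmpH (Hz h)) => y1; last first.
  split; last exact: neg.
  by apply: (cone_le_trans coneP _ w31); rewrite -(expg1n _ n); apply: cone_leX.
split; last first.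
  apply: (cone_le_trans coneP _ w31); rewrite -(expg1n _ n).
  by apply/cone_leX/cone_leV1.
have yV : [~ z, h^-1]^-1 = [~ z, h] ^ h^-1 by gword.
have y'1 : [~ z, h^-1] ⪯ 1.
  by rewrite -[[~ z, _]]invgK yV; apply/cone_leV1/cone_ge1J.
apply: (cone_le_trans coneP _ (neg _ (2 * n)%N y'1)).
rewrite expgnA yV expg2; apply: cone_leX => //.
exact: small_conj_mul_ge.
Qed.

End Small.
End Infinitesimals.

(** * Maximal cones and products of conjugates *)

Definition maximal_cone (G : groupType) (P : set G) : Prop :=
  cone P /\ forall Q, cone Q -> P `<=` Q -> Q `<=` P.

Definition conj_prod (G : groupType) (x : G) (s : seq G) : G :=
  \prod_(a <- s) x ^ a.

Section ConjugateProducts.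
Variables (G : groupType) (x : G).

Lemma conj_prod_cat s t : conj_prod x (s ++ t) = conj_prod x s * conj_prod x t.
Proof. exact: big_cat. Qed.

Lemma conj_prodJ s g : conj_prod x s ^ g = conj_prod x [seq a * g | a <- s].
Proof.
rewrite /conj_prod big_map conjg_prod.
by apply: eq_bigr => a _; rewrite conjgM.
Qed.

Lemma conj_prodV s : (conj_prod x^-1 s)^-1 = conj_prod x (rev s).
Proof.
rewrite /conj_prod; elim: s => [|a s IH]; first by rewrite !big_nil invg1.
by rewrite rev_cons -cats1 big_cat big_seq1 big_cons invgM IH conjVg invgK.
Qed.

Lemma conj_prodX s k : conj_prod x s ^+ k = conj_prod x (flatten (nseq k s)).
Proof.
elim: k => [|k IH]; first by rewrite /conj_prod big_nil.
by rewrite expgS IH /= conj_prod_cat.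
Qed.

Lemma conj_prod_mod (C : set G) s :
    normal_subgrp C -> (forall a, C [~ x, a]) ->
  C (x ^- size s * conj_prod x s).
Proof.
move=> [[C1 CM CV] CJ] Cx; rewrite /conj_prod.
elim: s => [|a s IH]; first by rewrite big_nil mulg1 invg1.
rewrite big_cons /= expgS.
set p := \prod_(_ <- _) _ in IH *; set k := x ^+ size s in IH *.
have -> : (x * k)^-1 * (x ^ a * p) = [~ x, a] ^ k * (k^-1 * p) by gword.
by apply: CM => //; apply: CJ.
Qed.

End ConjugateProducts.

Section MaximalCones.
Variables (G : groupType).

Lemma maximal_cone_exists (P0 : set G) :
  cone P0 -> exists2 P, P0 `<=` P & maximal_cone P.
Proof.
move=> coneP0.
have [F chF totF|A [coneA maxA]] := @Zorn_bigcup _ [set A | cone (A `|` P0)].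
- set U := \bigcup_(X in F) X.
  have sub Y : Y = set0 \/ F Y -> cone (Y `|` P0) /\ Y `|` P0 `<=` U `|` P0.
    case=> [->|FY]; first by rewrite set0U; split=> // ? ?; right.
    split; first exact: chF.
    by move=> z [Yz|]; [left; exists Y | right].
  have one z : (U `|` P0) z ->
      exists2 Y, Y = set0 \/ F Y & (Y `|` P0) z.
    by case=> [[Y FY Yz]|P0z]; [exists Y; [right | left] | exists set0; [left|right]].
  have two z t : (U `|` P0) z -> (U `|` P0) t ->
      exists2 Y, Y = set0 \/ F Y & (Y `|` P0) z /\ (Y `|` P0) t.
    move=> /one[Y FY Yz] /one[Z FZ Zt].
    suff [YZ|ZY] : Y `<=` Z \/ Z `<=` Y.
    - by exists Z => //; split=> //; case: Yz => [/YZ|]; [left | right].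
    - by exists Y => //; split=> //; case: Zt => [/ZY|]; [left | right].
    case: FY FZ => [->|FY] [->|FZ]; [by left | by left | by right |].
    exact: totF.
  split=> /=.
  + by move=> /one[Y /sub[[Y1 _ _] _]].
  + by move=> z t Uz /(two _ _ Uz)[Y /sub[[_ YM _] sY] [Yz Yt]]; apply/sY/YM.
  + by move=> z g /one[Y /sub[[_ _ YJ] sY] Yz]; apply/sY/YJ.
- exists (A `|` P0); first by move=> z; right.
  split=> // Q coneQ AQ z Qz; apply: contrapT => Az.
  have QE : Q `|` P0 = Q by apply: setUidl => t P0t; apply: AQ; right.
  apply: (maxA Q); last by rewrite /= QE.
  split; first by move=> t At; apply: AQ; left.
  by move=> QA; apply: Az; left; apply: QA.
Qed.

(** Otherwise adjoining to [P] the products of conjugates of [x] would give a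
    larger cone. *)
Lemma maximal_cone_prod_le1 (P : set G) (x : G) :
    maximal_cone P -> ~ comparable1 P x ->
  exists2 s, (0 < size s)%N & cone_le P (conj_prod x s) 1.
Proof.
move=> [coneP maxP] xP; apply: contrapT => noS.
have [P1 PM PJ] := coneP.
pose Q : set G := [set q | P q \/ exists p s,
  [/\ cone_le P 1 p, (0 < size s)%N & q = p * conj_prod x s]].
have coneQ : cone Q.
  split.
  - case=> // -[p [s [p1 s0]]] /esym/eqP; rewrite mulg_eq1 => /eqP pE.
    by apply: noS; exists s => //; move: p1; rewrite pE => /(cone_leV1 coneP); rewrite invgK.
  - move=> y z [Py|[p [s [p1 s0 ->]]]] [Pz|[q [t [q1 t0 ->]]]].
    + by left; apply: PM.
    + right; exists (y * q), t; split=> //; last by rewrite mulgA.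
      by apply: cone_ge1M => //; rewrite cone_le1; right.
    + right; exists (p * z ^ (conj_prod x s)^-1), s; split=> //; last by gword.
      by apply: cone_ge1M => //; rewrite cone_le1; right; apply: PJ.
    + right; exists (p * q ^ (conj_prod x s)^-1), (s ++ t).
      rewrite size_cat ltn_addr // conj_prod_cat; split=> //; last by gword.
      by apply: cone_ge1M => //; apply: cone_ge1J.
  - move=> z g [Pz|[p [s [p1 s0 ->]]]]; first by left; apply: PJ.
    right; exists (p ^ g), [seq a * g | a <- s].
    by rewrite size_map -conj_prodJ conjMg; split=> //; apply: cone_ge1J.
apply: xP; left; rewrite cone_le1; right.
apply: (maxP Q) => //; first by move=> z; left.
right; exists 1, [:: 1]; split=> //; first exact: cone_le_refl.
by rewrite /conj_prod big_seq1 mul1g conjg1.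
Qed.

Lemma maximal_cone_prods (P : set G) (x : G) :
    maximal_cone P -> ~ comparable1 P x ->
  exists s t, [/\ (0 < size s)%N, (0 < size t)%N,
    cone_le P (conj_prod x s) 1 & cone_le P 1 (conj_prod x t)].
Proof.
move=> maxP xP; have [coneP _] := maxP.
have [s s0 sP] := maximal_cone_prod_le1 maxP xP.
have [|t t0 tP] := @maximal_cone_prod_le1 P x^-1 maxP.
  by case=> [/(cone_leV1 coneP)|/(cone_le1V coneP)]; rewrite invgK => x1;
    apply: xP; do ?[by left | by right].
exists s, (rev t); rewrite size_rev; split=> //.
by rewrite -conj_prodV; apply: cone_le1V.
Qed.

End MaximalCones.

(** * Nilpotent groups *)

Definition central_series (G : groupType) (C : nat -> set G) (n : nat) : Prop :=
  [/\ C 0 = [set: G], C n = [set 1],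
      forall i, normal_subgrp (C i), forall i, C i.+1 `<=` C i &
      forall i x g, C i x -> C i.+1 [~ x, g]].

Section NilpotentCones.
Variables (G : groupType) (C : nat -> set G) (n : nat) (P : set G).
Hypotheses (serC : central_series C n) (coneP : cone P).

Let Cn : C n = [set 1]. Proof. by case: serC. Qed.
Let nC i : normal_subgrp (C i). Proof. by case: serC. Qed.
Let CS i : C i.+1 `<=` C i. Proof. by case: serC. Qed.
Let CR i x g : C i x -> C i.+1 [~ x, g]. Proof. by case: serC => _ _ _ _; apply. Qed.

Local Notation "x ⪯ y" := (cone_le P x y) (at level 70).

(** The conjugates of a positive [x] are positive, so that [commg_bound] applies
    with [w] and [z] both equal to [x]. *)
Lemma nilpotent_small_commutators i :
    (i <= n)%N -> (forall x, C i x -> comparable1 P x) ->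
  small_commutators P (C i).
Proof.
move=> /subnKC; move: (n - i)%N => k; elim: k i => [|k IH] i ikn cmpC x g Cx x1.
  move: Cx; rewrite -[i]addn0 ikn Cn => ->; rewrite comm1g.
  split=> // m; rewrite invg1 expg1n; split; exact: cone_le_refl.
have cmpS y : C i.+1 y -> comparable1 P y by move=> /CS/cmpC.
have small : small_commutators P (C i.+1) by apply: IH; rewrite // addSnnS.
apply: (infinitesimal_root coneP (nC i)) => //.
suff [CRx bnd] : infinitesimal P (C i.+1) (x ^+ 3) [~ x, g].
  by split=> //; apply: CS.
apply: (commg_bound coneP (nC i.+1) cmpS small) => //.
- by move=> h; apply: CR.
- exact: cone_le_refl.
- move=> h; apply: (@cone_le_trans _ _ coneP 1); last exact: cone_ge1J.
  exact/cone_leV1/cone_ge1X.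
Qed.

(** A commutator [[~ x, h]] is no larger than [[~ x ^+ m, h]]. *)
Lemma infinitesimal_comm_root H w x h m :
    H [~ x, h] -> comparable1 P [~ x, h] -> 1 ⪯ w -> (0 < m)%N ->
  infinitesimal P H w [~ x ^+ m, h] -> infinitesimal P H w [~ x, h].
Proof.
move=> Hy cmpy w1 m0 [_ inf]; split=> // k; have [inf1 inf2] := inf k.
have tr := cone_le_trans coneP.
case: cmpy => y1; split.
- by apply: tr inf1; apply: cone_leX => //; apply: commgX_ge.
- apply: tr w1; rewrite -(expg1n _ k); apply: cone_leX => //.
  exact: cone_leV1.
- by apply: tr w1; rewrite -(expg1n _ k); apply: cone_leX.
- by apply: tr inf2; apply: cone_leX => //; apply: cone_leV => //; apply: commgX_le.
Qed.

(** By descending induction along the series. If [x] in [C i] were incomparable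
    to [1], two products of conjugates of [x] would satisfy [u <= 1 <= v], and
    powers of them would be [x ^+ N * c] and [x ^+ N * d] with [c], [d] in
    [C i.+1]. Then [x ^+ N] lies between [w^-1] and [w], where [w] is the larger
    of [c^-1] and [d], and so all the [[~ x, h]] are infinitesimal with respect
    to [w]. But [c] and [d] are products of conjugates of these commutators, so
    that [w] is infinitesimal with respect to itself. *)
Lemma nilpotent_maximal_cone_total :
    torsion_free G -> maximal_cone P -> forall x, comparable1 P x.
Proof.
move=> tfG maxP; have [C0 _ _ _ _] := serC.
suff cmpC i : (i <= n)%N -> forall x, C i x -> comparable1 P x.
  by move=> x; apply: (cmpC 0) => //; rewrite C0.
move=> /subnKC; move: (n - i)%N => k; elim: k i => [|k IH] i ikn x Cx.
  by move: Cx; rewrite -[i]addn0 ikn Cn => ->; left; left.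
have cmpS y : C i.+1 y -> comparable1 P y by apply: IH; rewrite addSnnS.
have small : small_commutators P (C i.+1).
  by apply: nilpotent_small_commutators; rewrite // -ikn addnS ltnS leq_addr.
apply: contrapT => xP.
have [s [t [s0 t0 sP tP]]] := maximal_cone_prods maxP xP.
pose S := flatten (nseq (size t) s); pose T := flatten (nseq (size s) t).
have [sizeS sizeT] : size S = (size s * size t)%N /\ size T = (size s * size t)%N.
  have szf m (r : seq G) : size (flatten (nseq m r)) = (m * size r)%N.
    by elim: m => //= m IHm; rewrite size_cat IHm mulSn.
  by rewrite !szf; split=> //; rewrite mulnC.
have SP : conj_prod x S ⪯ 1.
  by rewrite -conj_prodX -(expg1n _ (size t)); apply: cone_leX.
have TP : 1 ⪯ conj_prod x T by rewrite -conj_prodX; apply: cone_ge1X.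
set N := (size s * size t)%N in sizeS sizeT.
have N0 : (0 < N)%N by rewrite muln_gt0 s0.
have CRx h : C i.+1 [~ x, h] by apply: CR.
pose z := x ^+ N; pose c := z^-1 * conj_prod x S; pose d := z^-1 * conj_prod x T.
have cd_in D : normal_subgrp D -> (forall h, D [~ x, h]) -> D c /\ D d.
  by move=> nD Dx; rewrite /c /d /z -{1}sizeS -sizeT; split; apply: conj_prod_mod.
have zc : z ⪯ c^-1.
  by rewrite /c invgM invgK; apply/cone_le_mull1 => //; apply: cone_le1V.
have dz : d^-1 ⪯ z.
  rewrite /d invgM invgK -{2}[z]mul1g; apply/cone_leMr => //; exact: cone_leV1.
have [w [w1 cw dw Dw]] : exists w, [/\ 1 ⪯ w, c^-1 ⪯ w, d ⪯ w &
    forall D, subgrp D -> D c -> D d -> D w].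
  have [Cc Cd] := cd_in _ (nC i.+1) CRx.
  have [_ CM CV] := proj1 (nC i.+1).
  have tr := cone_le_trans coneP.
  case: (cone_total coneP (nC _) cmpS (CV _ Cc) Cd) => [cd | dc].
    case: (cmpS _ Cd) => d1; first by exists d; split=> //; left.
    exists 1; split=> //; [by left | exact: tr d1 | by move=> D []].
  case: (cmpS _ (CV _ Cc)) => c1.
    by exists c^-1; split=> //; [left | move=> D [_ _ DV] /DV].
  exists 1; split=> //; [by left | exact: tr c1 | by move=> D []].
have Cw : C i.+1 w.
  by have [Cc Cd] := cd_in _ (nC i.+1) CRx; apply: Dw => //; case: (nC i.+1).
have zw : z ⪯ w by apply: cone_le_trans cw.
have wz : w^-1 ⪯ z by apply: cone_le_trans dz => //; apply: cone_leV.
have infz h : infinitesimal P (C i.+1) w [~ z, h].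
  apply: infinitesimal_root => //; apply: commg_bound => // g.
    by apply: CR; apply: (subgrpX (proj1 (nC i))).
  apply: (cone_le_trans coneP _ (cone_leJ coneP g wz)).
  by rewrite conjVg expg2; apply: cone_leV => //; apply: (small_conj_le2 small).
have nD := infinitesimal_normal coneP (nC i.+1) cmpS small w1.
have [] := cd_in _ nD _.
  by move=> h; apply: infinitesimal_comm_root (infz h) => //; apply: cmpS.
move=> /Dw /[apply]; case: (nD) => + _ => /[swap] /[apply] -[_ /(_ 2%N) [w2 _]].
have {}w1 : w = 1.
  apply: (cone_le_anti coneP _ w1); move: w2 => /(cone_leMl w^-1).
  by rewrite expg2 mulKg mulVg.
apply: xP; left; left; apply/esym/(tfG _ N) => //.
apply: (cone_le_anti coneP); first by rewrite -[X in _ ⪯ X]w1.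
by move: wz; rewrite w1 invg1.
Qed.

End NilpotentCones.

(** * Locally nilpotent groups *)

Section SubgroupType.
Variables (G : groupType) (K : set G) (gK : subgrp K).

(** The closure proof is an argument of the type so that the group structure can
    be attached to it. *)
Definition subgroup_type of subgrp K : Type := {x : G | x \in K}.
Local Notation T := (subgroup_type gK).

HB.instance Definition _ := Choice.on T.

Let inK (x : T) : K (\val x). Proof. exact: set_mem (valP x). Qed.
Let one_in : K 1. Proof. by case: gK. Qed.
Let inv_in (x : T) : K (\val x)^-1.
Proof. by case: gK => _ _; apply; apply: inK. Qed.
Let mul_in (x y : T) : K (\val x * \val y).
Proof. by case: gK => _ + _; apply; apply: inK. Qed.

Let sub_one : T := exist _ 1 (mem_set one_in).
Let sub_inv (x : T) : T := exist _ (\val x)^-1 (mem_set (inv_in x)).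
Let sub_mul (x y : T) : T := exist _ (\val x * \val y) (mem_set (mul_in x y)).

Let sub_mulA : associative sub_mul.
Proof. by move=> x y z; apply: val_inj; apply: mulgA. Qed.
Let sub_mul1g : left_id sub_one sub_mul.
Proof. by move=> x; apply: val_inj; apply: mul1g. Qed.
Let sub_mulg1 : right_id sub_one sub_mul.
Proof. by move=> x; apply: val_inj; apply: mulg1. Qed.
Let sub_mulVg : left_inverse sub_one sub_inv sub_mul.
Proof. by move=> x; apply: val_inj; apply: mulVg. Qed.
Let sub_mulgV : right_inverse sub_one sub_inv sub_mul.
Proof. by move=> x; apply: val_inj; apply: mulgV. Qed.

HB.instance Definition _ :=
  isGroup.Build T sub_mulA sub_mul1g sub_mulg1 sub_mulVg sub_mulgV.

Definition subgroup_incl (x : T) : G := \val x.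

Lemma subgroup_incl_inj : injective subgroup_incl.
Proof. exact: val_inj. Qed.

Lemma subgroup_inclM : {morph subgroup_incl : x y / x * y}.
Proof. by []. Qed.

Lemma subgroup_incl_onto a : K a -> exists b, subgroup_incl b = a.
Proof. by move=> Ka; exists (exist _ a (mem_set Ka)). Qed.

End SubgroupType.

Section GroupMorphism.
Variables (G H : groupType) (f : G -> H).
Hypothesis fM : {morph f : x y / x * y}.

Lemma morphM1 : f 1 = 1.
Proof. by apply: (mulgI (f 1)); rewrite -fM !mulg1. Qed.

Lemma morphMV x : f x^-1 = (f x)^-1.
Proof. by apply: (mulgI (f x)); rewrite -fM !mulgV morphM1. Qed.

Lemma morphMX x n : f (x ^+ n) = f x ^+ n.
Proof. by elim: n => [|n IH]; [apply: morphM1 | rewrite !expgS fM IH]. Qed.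

Lemma morphMJ x g : f (x ^ g) = f x ^ f g.
Proof. by rewrite !conjgE !fM morphMV. Qed.

Lemma morphMR x g : f [~ x, g] = [~ f x, f g].
Proof. by rewrite !commgEl fM morphMV morphMJ. Qed.

Lemma morphM_conj_prod x s : f (conj_prod x s) = conj_prod (f x) (map f s).
Proof.
rewrite /conj_prod; elim: s => [|a s IH]; first by rewrite !big_nil morphM1.
by rewrite /= !big_cons fM morphMJ IH.
Qed.

Lemma preimage_cone (P : set H) : cone P -> cone (f @^-1` P).
Proof.
move=> [P1 PM PJ]; split=> /=; first by rewrite morphM1.
  by move=> x y; rewrite fM; apply: PM.
by move=> x g; rewrite morphMJ; apply: PJ.
Qed.

End GroupMorphism.

Lemma subgroup_generated_subgrp (G : groupType) (X : set G) :
  subgrp (subgroup_generated X).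
Proof.
have closed (H : set G) : group_closed (mem H) -> subgrp H.
  move=> cH; have [/set_mem H1 _] := cH; split=> //.
    by move=> x y /mem_set Hx /mem_set Hy; apply/set_mem/(group_closedM cH).
  by move=> x /mem_set Hx; apply/set_mem/(group_closedV cH).
split.
- by move=> H /= [/closed[]].
- move=> x y Hx Hy H /= HX; have [/closed[_ HM _] _] := HX.
  by apply: HM; [apply: Hx | apply: Hy].
- move=> x Hx H /= HX; have [/closed[_ _ HV] _] := HX.
  by apply: HV; apply: Hx.
Qed.

Lemma subgroup_generated_min (G : groupType) (X H : set G) :
  subgrp H -> X `<=` H -> subgroup_generated X `<=` H.
Proof.
move=> [H1 HM HV]; apply: smallest_sub; split; first exact: mem_set.
by move=> x y /set_mem Hx /set_mem Hy; apply/mem_set/HM => //; apply: HV.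
Qed.

Section LowerCentral.
Variables (G : groupType) (H : set G).
Hypothesis gH : subgrp H.

Lemma lower_central_subgrp i : subgrp (lower_central H i).
Proof. by case: i => [|i] //; apply: subgroup_generated_subgrp. Qed.

Lemma lower_central_comm i x y :
  lower_central H i x -> H y -> lower_central H i.+1 [~ x, y].
Proof. by move=> Hx Hy; apply: sub_gen_smallest; exists x, y. Qed.

Lemma lower_centralS i : lower_central H i.+1 `<=` lower_central H i.
Proof.
elim: i => [|i IH]; apply: subgroup_generated_min;
  try by [exact: gH | exact: (lower_central_subgrp i.+1)].
- move=> _ [x [y [Hx Hy ->]]]; have [_ HM HV] := gH; rewrite commgEl conjgE.
  by apply: (HM); [apply: (HV) | apply: (HM) => //; [apply: (HV) | apply: HM]].
- by move=> _ [x [y [/IH Hx Hy ->]]]; apply: lower_central_comm.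
Qed.

End LowerCentral.

Definition nilpotent_group (K : groupType) : Prop :=
  exists C n, @central_series K C n.

Lemma finitely_generated_nilpotent (G : groupType) (s : seq G) :
    locally_nilpotent G ->
  exists (K : groupType) (f : K -> G),
    [/\ injective f, {morph f : x y / x * y}, nilpotent_group K &
        forall a, a \in s -> exists b, f b = a].
Proof.
move=> /(_ [set` s] (finite_seq s))[n nilH].
have := subgroup_generated_subgrp [set` s].
have: [set` s] `<=` subgroup_generated [set` s] by apply: sub_gen_smallest.
move: (subgroup_generated _) nilH => H nilH sH gH.
pose f := @subgroup_incl G H gH.
have finj : injective f by apply: subgroup_incl_inj.
have fM : {morph f : x y / x * y} by apply: subgroup_inclM.
have fH x : H (f x) by apply: (set_mem (valP x)).
exists (subgroup_type gH), f; split=> //; last first.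
  by move=> a /sH/(subgroup_incl_onto gH).
exists (fun i => f @^-1` lower_central H i), n; split.
- by apply/seteqP; split=> // x _; apply: fH.
- apply/seteqP; rewrite nilH /=; split=> x /=; last by move->; apply: morphM1.
  by move=> fx; apply: finj; rewrite fx morphM1.
- move=> i; have [H1 HM HV] := lower_central_subgrp gH i.
  split; first split=> /=; rewrite ?morphM1 //.
  + by move=> x y; rewrite fM; apply: HM.
  + by move=> x; rewrite morphMV //; apply: HV.
  + move=> x g /= Hx; rewrite morphMJ //.
    have -> : f x ^ f g = f x * [~ f x, f g] by gword.
    by apply: HM => //; apply: lower_centralS => //; apply: lower_central_comm.
- by move=> i x /=; apply: lower_centralS.
- by move=> i x g /= Hx; rewrite morphMR //; apply: lower_central_comm.
Qed.

Lemma conj_prod_gt1 (G : groupType) (P : set G) x s :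
  cone P -> P x -> (0 < size s)%N -> P (conj_prod x s).
Proof.
move=> [_ PM PJ] Px; case: s => // a s _; rewrite /conj_prod.
elim: s a => [|b s IH] a; first by rewrite big_seq1; apply: PJ.
by rewrite big_cons; apply: PM (IH b); apply: PJ.
Qed.

Definition total_cone (G : groupType) (P : set G) : Prop :=
  cone P /\ forall x, comparable1 P x.

Lemma total_coneVP (G : groupType) (P : set G) x :
  total_cone P -> x <> 1 -> ~ P x -> P x^-1.
Proof.
move=> [coneP tot] x1 Px; case: (tot x); first by rewrite cone_le1 => -[].
by move=> /(cone_le1V coneP); rewrite cone_le1 => -[/eqP|//]; rewrite invg_eq1 => /eqP.
Qed.

Section LocallyNilpotent.
Variable G : groupType.
Hypothesis nilG : locally_nilpotent G.

(** An obstruction to enlarging a cone involves finitely many elements, and is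
    refuted by a total order on the nilpotent subgroup they generate. *)
Theorem total_cone_extension (P0 : set G) :
  torsion_free G -> cone P0 -> exists2 P, P0 `<=` P & total_cone P.
Proof.
move=> tfG /maximal_cone_exists[P P0P maxP]; have [coneP _] := maxP.
exists P => //; split=> // x; apply: contrapT => xP.
have [s [t [s0 t0 sP tP]]] := maximal_cone_prods maxP xP.
have [K [f [finj fM [C [n serC]] fsurj]]] :=
  finitely_generated_nilpotent (x :: s ++ t) nilG.
have tfK : torsion_free K.
  move=> y m m0 ym; apply: finj; rewrite (morphM1 fM).
  by apply: (tfG _ m m0); rewrite -(morphMX fM) ym (morphM1 fM).
have lift r : {subset r <= x :: s ++ t} -> exists r', r = map f r'.
  elim: r => [|a r IH] sub; first by exists [::].
  have [|r' ->] := IH; first by move=> b br; apply: sub; rewrite in_cons br orbT.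
  have [|b <-] := fsurj a; first by apply: sub; rewrite mem_head.
  by exists (b :: r').
have [y yE] := fsurj x (mem_head _ _).
have [|s' sE] := lift s.
  by move=> a sa; rewrite in_cons mem_cat sa orbT.
have [|t' tE] := lift t.
  by move=> a ta; rewrite in_cons mem_cat ta !orbT.
have [Q PQ maxQ] := maximal_cone_exists (preimage_cone fM coneP).
have [coneQ _] := maxQ.
have leQ u : cone_le P 1 (f u) -> cone_le Q 1 u.
  rewrite !cone_le1 => -[fu|Pfu]; last by right; apply: PQ.
  by left; apply: finj; rewrite fu (morphM1 fM).
have geQ u : cone_le P (f u) 1 -> cone_le Q u 1.
  move=> /(cone_le1V coneP); rewrite -(morphMV fM) => /leQ/(cone_leV1 coneQ).
  by rewrite invgK.
have Q1 : ~ Q 1 by case: coneQ.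
have no u : Q u -> cone_le Q u 1 -> False.
  by case: coneQ => _ QM _ Qu [u1|Qu1]; apply: Q1; [rewrite -u1 | have := QM _ _ Qu Qu1; gword].
case: (nilpotent_maximal_cone_total serC coneQ tfK maxQ y).
- rewrite cone_le1 => -[y1|Qy].
    by apply: xP; rewrite -yE y1 (morphM1 fM); left; left.
  apply: (no (conj_prod y s')).
    by apply: conj_prod_gt1 => //; move: s0; rewrite sE size_map.
  by apply: geQ; rewrite (morphM_conj_prod fM) yE -sE.
- move=> /(cone_le1V coneQ); rewrite cone_le1 => -[/eqP|Qy].
    rewrite invg_eq1 => /eqP y1.
    by apply: xP; rewrite -yE y1 (morphM1 fM); left; left.
  apply: (no (conj_prod y^-1 (rev t'))).
    by apply: conj_prod_gt1 => //; move: t0; rewrite tE size_map size_rev.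
  rewrite -[conj_prod _ _]invgK conj_prodV revK; apply: cone_leV1 => //.
  by apply: leQ; rewrite (morphM_conj_prod fM) yE -tE.
Qed.

Lemma locally_nilpotent_small_commutators (P : set G) :
  total_cone P -> small_commutators P [set: G].
Proof.
move=> [coneP tot] x g _ x1.
have [K [f [finj fM [C [n serC]] fsurj]]] :=
  finitely_generated_nilpotent [:: x; g] nilG.
have [y yE] : exists y, f y = x by apply: fsurj; rewrite mem_head.
have [h hE] : exists h, f h = g by apply: fsurj; rewrite !inE eqxx orbT.
pose Q := f @^-1` P; have coneQ : cone Q := preimage_cone fM coneP.
have leE a b : cone_le P (f a) (f b) <-> cone_le Q a b.
  rewrite /cone_le /Q /= fM (morphMV fM); split=> -[ab|]; [|by right | |by right].
    by left; apply: finj.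
  by left; rewrite ab.
have [C0 _ _ _ _] := serC.
have small : small_commutators Q (C 0).
  apply: (nilpotent_small_commutators serC coneQ) => // a _.
  by case: (tot (f a)); rewrite -(morphM1 fM) => /leE; [left | right].
have [_ inf] : infinitesimal Q (C 0) y [~ y, h].
  apply: small; first by rewrite C0.
  by apply/leE; rewrite (morphM1 fM) yE.
split=> // m; rewrite -yE -hE -(morphMR fM) -(morphMV fM) -!(morphMX fM) !leE.
exact: inf.
Qed.

End LocallyNilpotent.

(** * Convex subgroups of a total order *)

(** For a total cone this is convexity of [E]: the positive elements outside [E]
    lie above every element of [E]. In this form it makes sense for the cone
    obtained by reversing the order on a larger subgroup. *)
Definition convex (G : groupType) (P E : set G) : Prop :=
  forall x e, P x -> ~ E x -> E e -> P (x * e).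

Definition convex_hull (G : groupType) (P : set G) (w : G) : set G :=
  [set a | exists n, cone_le P a (w ^+ n) /\ cone_le P a^-1 (w ^+ n)].

(** The cone obtained from [P] by reversing the order on [E]. *)
Definition flip (G : groupType) (P E : set G) : set G :=
  [set x | P x /\ ~ E x \/ P x^-1 /\ E x].

Section ConvexSubgroups.
Variables (G : groupType) (P : set G).
Hypothesis totP : total_cone P.

Local Notation "x ⪯ y" := (cone_le P x y) (at level 70).
Local Notation infin := (infinitesimal P [set: G]).
Local Notation hull := (convex_hull P).

Let coneP : cone P. Proof. by case: totP. Qed.
Let P1 : ~ P 1. Proof. by case: coneP. Qed.
Let PM x y : P x -> P y -> P (x * y). Proof. by case: coneP => _ + _; apply. Qed.
Let PJ x g : P x -> P (x ^ g). Proof. by case: coneP => _ _; apply. Qed.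
Let cmpT x : [set: G] x -> comparable1 P x. Proof. by case: totP. Qed.
Let nT : normal_subgrp [set: G]. Proof. by []. Qed.

Lemma total_le x y : x ⪯ y \/ y ⪯ x.
Proof. exact: (cone_total coneP nT cmpT). Qed.

Lemma interval_convex E :
    subgrp E -> (forall x e, 1 ⪯ x -> x ⪯ e -> E e -> E x) -> convex P E.
Proof.
move=> [_ _ EV] cE x e Px Ex Ee; apply: contrapT => Pxe; apply: Ex.
apply: (cE _ e^-1); [by rewrite cone_le1; right | | exact: EV].
case: (cmpT (x := x * e)) => //; first rewrite cone_le1 => -[xe1 |//].
  by left; apply/eqP; rewrite -mulg_eq1 xe1.
by move=> /(cone_leMr coneP e^-1); rewrite mulgK mul1g.
Qed.

Lemma convex_interval E x e :
  subgrp E -> convex P E -> 1 ⪯ x -> x ⪯ e -> E e -> E x.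
Proof.
move=> [E1 _ EV] cE; rewrite cone_le1 => -[-> //|Px] xe Ee.
apply: contrapT => /(cE _ _ Px) /(_ (EV _ Ee)) Pxe.
case: xe => [xe|Pxe']; first by move: Pxe; rewrite xe mulgV.
by apply: P1; have := PM Pxe (PJ e^-1 Pxe'); gword.
Qed.

Lemma convex_posM E x y : subgrp E -> convex P E ->
  P x -> ~ E x -> P y -> P (x * y) /\ ~ E (x * y).
Proof.
move=> gE cE Px Ex Py; split; first exact: PM.
move=> Exy; apply: Ex; apply: (convex_interval gE cE) Exy.
- by rewrite cone_le1; right.
- by apply: cone_le_mul1; rewrite cone_le1; right.
Qed.

Lemma convex_root E x n : subgrp E -> convex P E -> (0 < n)%N -> E (x ^+ n) -> E x.
Proof.
move=> gE cE n0; have [_ _ EV] := gE.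
have pos y : 1 ⪯ y -> E (y ^+ n) -> E y.
  by move=> y1; apply: convex_interval => //; apply: cone_le_X.
case: (cmpT (x := x)) => // x1 Ex; first exact: pos.
rewrite -[x]invgK; apply/EV/pos; first exact: cone_le1V.
by rewrite expVgn; apply: EV.
Qed.

Section Hull.
Hypothesis small : small_commutators P [set: G].

Lemma infinitesimal_subgrp w : 1 ⪯ w -> normal_subgrp (infin w).
Proof. exact: infinitesimal_normal. Qed.

Lemma infinitesimal_convex w : 1 ⪯ w -> convex P (infin w).
Proof.
move=> w1; apply: interval_convex; first by case: (infinitesimal_subgrp w1).
move=> x e x1 xe [_ ie]; split=> // n; split.
  by apply: (cone_le_trans coneP _ (proj1 (ie n))); apply: cone_leX.
by apply: (cone_le_trans coneP _ w1); rewrite -(expg1n _ n); apply/cone_leX/cone_leV1.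
Qed.

Lemma infinitesimal_self w : 1 ⪯ w -> infin w w -> w = 1.
Proof.
move=> w1 [_ /(_ 2%N) [w2 _]]; apply: (cone_le_anti coneP _ w1).
by move: w2 => /(cone_leMl w^-1); rewrite expg2 mulKg mulVg.
Qed.

Lemma hull_subgrp w : 1 ⪯ w -> normal_subgrp (hull w).
Proof.
move=> w1; split; first split.
- by exists 0%N; rewrite invg1; split; left.
- move=> a b [n [an aVn]] [m [bm bVm]]; exists (n + m)%N; rewrite invgM; split.
    by rewrite expgnDr; apply: cone_leM.
  by rewrite addnC expgnDr; apply: cone_leM.
- by move=> a [n [an aVn]]; exists n; rewrite invgK.
- move=> a g [n [an aVn]]; exists (n + n)%N; rewrite -conjVg expgnDr.
  have wn : 1 ⪯ w ^+ n by apply: cone_ge1X.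
  by split; apply: (cone_le_trans coneP (cone_leJ coneP g _)) (small_conj_le2 small g _ wn).
Qed.

Lemma hull_convex w : 1 ⪯ w -> convex P (hull w).
Proof.
move=> w1; apply: interval_convex; first by case: (hull_subgrp w1).
move=> x e x1 xe [n [en _]]; exists n; split; first exact: cone_le_trans en.
by apply: (cone_le_trans coneP (cone_leV1 coneP x1)); apply: cone_ge1X.
Qed.

Lemma hull_self w : 1 ⪯ w -> hull w w.
Proof.
move=> w1; exists 1%N; split; first by left.
by apply: (cone_le_trans coneP (cone_leV1 coneP w1)).
Qed.

Lemma hull_min E w : subgrp E -> convex P E -> 1 ⪯ w -> E w -> hull w `<=` E.
Proof.
move=> gE cE w1 Ew; have [_ _ EV] := gE.
have pos a n : 1 ⪯ a -> a ⪯ w ^+ n -> E a.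
  by move=> a1 an; apply: convex_interval an _ => //; apply: subgrpX.
move=> a [n [an aVn]]; case: (cmpT (x := a)) => // a1; first exact: pos an.
by rewrite -[a]invgK; apply: EV; apply: pos aVn; apply: cone_le1V.
Qed.

Lemma hull_comm w x g : 1 ⪯ w -> hull w x -> infin w [~ x, g].
Proof.
move=> w1; have [[_ _ infV] infJ] := infinitesimal_subgrp w1.
have pos y n : 1 ⪯ y -> y ⪯ w ^+ n -> infin w [~ y, g].
  move=> y1 yw; apply: (infinitesimal_root coneP nT cmpT (m := n)) => //.
  have [_ iy] := small g I y1; split=> // k; have [iy1 iy2] := iy k.
  by split; apply: (cone_le_trans coneP _ yw).
move=> [n [xn xVn]]; case: (cmpT (x := x)) => // x1; first exact: pos xn.
have -> : [~ x, g] = [~ x^-1, g]^-1 ^ x by gword.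
by apply/infJ/infV/(pos _ n) => //; apply: cone_le1V.
Qed.

End Hull.

Section Flip.
Variable E : set G.
Hypotheses (nE : normal_subgrp E) (cE : convex P E).

Let E1 : E 1. Proof. by case: nE => -[]. Qed.
Let EM x y : E x -> E y -> E (x * y). Proof. by case: nE => -[_ + _] _; apply. Qed.
Let EV x : E x -> E x^-1. Proof. by case: nE => -[_ _ +] _; apply. Qed.
Let EJ x g : E x -> E (x ^ g). Proof. by case: nE => _; apply. Qed.
Let gE : subgrp E. Proof. by case: nE. Qed.

Let convexl x e : P x -> ~ E x -> E e -> P (e * x) /\ ~ E (e * x).
Proof.
move=> Px Ex Ee; split; last by move=> /(subgrp_mull gE Ee).
by have := PJ e^-1 (cE Px Ex Ee); gword.
Qed.

Let convexr x e : P x -> ~ E x -> E e -> P (x * e) /\ ~ E (x * e).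
Proof.
move=> Px Ex Ee; split; last by move=> /(subgrp_mulr gE Ee).
exact: cE.
Qed.

Lemma flip_total : total_cone (flip P E).
Proof.
split; first split.
- by case=> [[/P1]|[]]; rewrite ?invg1.
- move=> x y [[Px Ex]|[Px Ex]] [[Py Ey]|[Py Ey]].
  + by left; apply: convex_posM.
  + by left; apply: convexr.
  + by left; apply: convexl.
  + by right; rewrite invgM; split; [apply: PM | apply: EM].
- move=> x g [[Px Ex]|[Px Ex]]; [left | right]; split.
  + exact: PJ.
  + by move=> /(EJ g^-1); rewrite conjgK.
  + by rewrite -conjVg; apply: PJ.
  + exact: EJ.
- move=> x; have [->|x1] := pselect (x = 1); first by left; left.
  have ge y : flip P E y -> cone_le (flip P E) 1 y by rewrite cone_le1; right.
  have le y : flip P E y^-1 -> cone_le (flip P E) y 1.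
    by right; rewrite mulg1.
  have [Px|/(total_coneVP totP x1) Px] := pselect (P x);
    have [Ex|Ex] := pselect (E x).
  + by right; apply: le; right; rewrite invgK; split=> //; apply: EV.
  + by left; apply: ge; left.
  + by left; apply: ge; right.
  + by right; apply: le; left; split=> // /EV; rewrite invgK.
Qed.

Lemma flip_convex (F : set G) :
  normal_subgrp F -> F `<=` E -> convex P F -> convex (flip P E) F.
Proof.
move=> [[_ _ FV] FJ] FE cF x e [[Px Ex]|[Px Ex]] Fx Fe.
  by left; apply: convexr => //; apply: FE.
right; split; last by apply: EM => //; apply: FE.
have -> : (x * e)^-1 = x^-1 * (e^-1) ^ x^-1 by gword.
by apply: cF => //; [move=> /FV; rewrite invgK | apply/FJ/FV].
Qed.

End Flip.
End ConvexSubgroups.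

(** * Orders determined by finitely many positive elements *)

Definition determined_by (G : groupType) (P : set G) (L : seq G) : Prop :=
  (forall l, l \in L -> P l) /\
  forall Q, total_cone Q -> (forall l, l \in L -> Q l) -> Q = P.

(** Otherwise the order could be reversed on the section [F] over [E] alone. *)
Lemma determined_meets_sections (G : groupType) (P : set G) L (E F : set G) x :
    total_cone P -> determined_by P L ->
    normal_subgrp E -> convex P E -> normal_subgrp F -> convex P F ->
    E `<=` F -> F x -> ~ E x ->
  exists2 l, l \in L & F l /\ ~ E l.
Proof.
move=> totP [PL detP] nE cE nF cF EF Fx Ex; apply: contrapT => noL.
have totQ := flip_total totP nF cF.
have cQE := flip_convex nF cF nE EF cE.
have totR := flip_total totQ nE cQE.
have RE : flip (flip P F) E = P.
  apply: detP => // l lL; have Pl := PL l lL.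
  have [El|El] := pselect (E l); last first.
    left; split=> //; left; split=> // Fl.
    by apply: noL; exists l.
  right; split=> //; right; rewrite invgK; split=> //.
  by case: nF => -[_ _ FV] _; apply/FV/EF.
have [_ _ EV] := proj1 nE; have [_ _ FV] := proj1 nF.
have no y : F y -> ~ E y -> P y -> False.
  move=> Fy Ey Py; move: (Py); rewrite -RE => -[[[[_ /(_ Fy)]|[PVy _]] _]|[_ /Ey]] //.
  by case: (proj1 totP) => P1 PM _; apply: P1; have := PM _ _ Py PVy; rewrite mulgV.
have [Px|Px] := pselect (P x); first exact: no Px.
have x1 : x <> 1 by move=> x1; apply: Ex; rewrite x1; case: nE => -[].
apply: no (FV _ Fx) _ (total_coneVP totP x1 Px).
by move=> /EV; rewrite invgK.
Qed.

(** * Abelian quotients *)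

Section AbelianQuotient.
Variables (G : groupType) (E : set G).
Hypotheses (gE : subgrp E) (ER : forall x g, E [~ x, g]).

Let E1 : E 1. Proof. by case: gE. Qed.
Let EM x y : E x -> E y -> E (x * y). Proof. by case: gE => _ + _; apply. Qed.
Let EV x : E x -> E x^-1. Proof. by case: gE => _ _; apply. Qed.

Definition coset_rel (x y : G) : bool := `[< E (x^-1 * y) >].

Let coset_rel_refl : reflexive coset_rel.
Proof. by move=> x; apply/asboolP; rewrite mulVg. Qed.

Let coset_rel_sym : symmetric coset_rel.
Proof.
by move=> x y; apply/asboolP/asboolP => /EV; rewrite invgM invgK.
Qed.

Let coset_rel_trans : transitive coset_rel.
Proof.
move=> y x z /asboolP xy /asboolP yz; apply/asboolP.
by have := EM xy yz; gword.
Qed.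

Canonical coset_equiv := EquivRel coset_rel coset_rel_refl coset_rel_sym coset_rel_trans.

(** As for [subgroup_type], the argument is what the group structure needs. *)
Definition abelian_quotient of (forall x g, E [~ x, g]) : Type :=
  {eq_quot coset_equiv}%qT.
Local Notation A := (abelian_quotient ER).

HB.instance Definition _ := Choice.on A.

Definition quotient_map (x : G) : A := \pi_({eq_quot coset_equiv})%qT x.

Lemma quotient_map_eq x y : quotient_map x = quotient_map y <-> E (x^-1 * y).
Proof. by split=> [/eqquotP/asboolP | Exy]; last by apply/eqquotP/asboolP. Qed.

Definition quotient_repr (u : A) : G := repr (u : {eq_quot coset_equiv}%qT).

Lemma quotient_reprK u : quotient_map (quotient_repr u) = u.
Proof. exact: (reprK (u : {eq_quot coset_equiv}%qT)). Qed.

Let zero : A := quotient_map 1.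
Let opp (u : A) : A := quotient_map (quotient_repr u)^-1.
Let add (u v : A) : A := quotient_map (quotient_repr u * quotient_repr v).

Let EJ x g : E x -> E (x ^ g).
Proof. by move=> Ex; have := EM Ex (ER x g); gword. Qed.

Let addE x y : add (quotient_map x) (quotient_map y) = quotient_map (x * y).
Proof.
apply/quotient_map_eq.
have /quotient_map_eq Ex := quotient_reprK (quotient_map x).
have /quotient_map_eq Ey := quotient_reprK (quotient_map y).
by have := EM (EJ (quotient_repr (quotient_map y)) Ex) Ey; gword.
Qed.

Let oppE x : opp (quotient_map x) = quotient_map x^-1.
Proof.
apply/quotient_map_eq.
have /quotient_map_eq Ex := quotient_reprK (quotient_map x).
by have := EJ x^-1 (EV Ex); gword; move=> /(EJ x); gword; move=> /EV/(EJ x^-1); gword.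
Qed.

Let addA : associative add.
Proof.
move=> u v w; rewrite -[u]quotient_reprK -[v]quotient_reprK -[w]quotient_reprK.
by rewrite !addE mulgA.
Qed.

Let addC : commutative add.
Proof.
move=> u v; rewrite -[u]quotient_reprK -[v]quotient_reprK !addE.
apply/quotient_map_eq.
by have := ER (quotient_repr v) (quotient_repr u); gword.
Qed.

Let add0 : left_id zero add.
Proof. by move=> u; rewrite -[u]quotient_reprK addE mul1g. Qed.

Let addN : left_inverse zero opp add.
Proof. by move=> u; rewrite -[u]quotient_reprK oppE addE mulVg. Qed.

HB.instance Definition _ := GRing.isZmodule.Build A addA addC add0 addN.

Lemma quotient_mapM x y :
  quotient_map (x * y) = (quotient_map x + quotient_map y)%R.
Proof. by rewrite -addE. Qed.

Lemma quotient_map_eq0 x : quotient_map x = 0%R <-> E x.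
Proof.
rewrite (_ : 0%R = quotient_map 1) // quotient_map_eq mulg1.
by split=> /EV; rewrite ?invgK.
Qed.

Lemma quotient_map_surj u : exists x, quotient_map x = u.
Proof. by exists (quotient_repr u); apply: quotient_reprK. Qed.

End AbelianQuotient.

(** * Total orders on abelian groups with a finitely generated cone *)

Section AbelianCones.
Variables (A : zmodType) (Q : set A).
Local Open Scope ring_scope.

(** The recursion on [L] exposes the multiplicity of each generator, as needed to
    eliminate one generator at a time. *)
Fixpoint nat_span (L : seq A) : set A :=
  if L is g :: L' then [set a | exists k, nat_span L' (a - g *+ k)] else [set 0].

Definition generates_cone (L : seq A) : Prop :=
  forall q, Q q -> exists2 N, (0 < N)%N & nat_span L (q *+ N).

Lemma nat_span0 L : nat_span L 0.
Proof. by elim: L => // g L IH; exists 0%N; rewrite mulr0n subr0. Qed.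

Lemma nat_spanD L a b : nat_span L a -> nat_span L b -> nat_span L (a + b).
Proof.
elim: L a b => [a b -> ->|g L IH a b [k ak] [m bm]]; first by rewrite addr0.
by exists (k + m)%N; rewrite mulrnDr opprD addrACA; apply: IH.
Qed.

Lemma nat_spanMn L a n : nat_span L a -> nat_span L (a *+ n).
Proof.
move=> La; elim: n => [|n IH]; first exact: nat_span0.
by rewrite mulrS; apply: nat_spanD.
Qed.

Lemma nat_span_cons g L a : nat_span L a -> nat_span (g :: L) a.
Proof. by exists 0%N; rewrite mulr0n subr0. Qed.

Lemma nat_span_mem L a : a \in L -> nat_span L a.
Proof.
elim: L => // g L IH; rewrite in_cons => /orP[/eqP->|/IH].
  by exists 1%N; rewrite mulr1n subrr; apply: nat_span0.
exact: nat_span_cons.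
Qed.

Lemma nat_span_swap g p L : nat_span (g :: p :: L) `<=` nat_span (p :: g :: L).
Proof. by move=> a [k [m am]]; exists m, k; rewrite addrAC. Qed.

Hypothesis Q0 : ~ Q 0.
Hypothesis QD : forall a b, Q a -> Q b -> Q (a + b).

Let QX a n : (0 < n)%N -> Q a -> Q (a *+ n).
Proof.
by case: n => // n _ Qa; elim: n => [|n IH]; rewrite ?mulr1n // mulrS; apply: QD.
Qed.

Lemma nat_span_ge0 L a : (forall g, g \in L -> Q g) -> nat_span L a -> a = 0 \/ Q a.
Proof.
elim: L a => [a _ ->|g L IH a LQ [k]]; first by left.
have {}IH := IH _ (fun h hL => LQ h (mem_behead (s := g :: L) hL)).
have Qg : Q g by apply: LQ; rewrite mem_head.
rewrite -{2 3}[a](subrK (g *+ k)); case: k => [|k] /IH.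
  by rewrite mulr0n addr0.
by case=> [->|Qa]; right; rewrite ?add0r; [apply: QX | apply/QD/QX].
Qed.

(** If [g] is at least [p], a multiple of [g - p] lies in the span of [g], [p]
    and [L], and positivity leaves a multiple of [g] in the span of [p] and [L]. *)
Lemma generates_cone_drop g p L :
    (forall h, h \in p :: L -> Q h) -> Q g -> g = p \/ Q (g - p) ->
    generates_cone (g :: p :: L) ->
  generates_cone (p :: L).
Proof.
move=> LQ Qg gp gen; have Qp : Q p by apply: LQ; rewrite mem_head.
have [j j0 gj] : exists2 j, (0 < j)%N & nat_span (p :: L) (g *+ j).
  case: gp => [->|/gen[N N0 [k gpk]]].
    by exists 1%N => //; apply: nat_span_mem; rewrite mem_head.
  have [kN|Nk] := ltnP k N.
    exists (N - k)%N; first by rewrite subn_gt0.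
    rewrite mulrnBr ?(ltnW kN) // -[g *+ N](subrK (p *+ N)) -mulrnBl addrAC.
    by apply: nat_spanD => //; apply/nat_spanMn/nat_span_mem; rewrite mem_head.
  exfalso; apply: Q0; pose z := p *+ N + g *+ (k - N).
  have Qz : Q z.
    rewrite /z; case: (posnP (k - N)%N) => [->|kN0]; last by apply: QD; apply: QX.
    by rewrite mulr0n addr0; apply: QX.
  have zE : (g - p) *+ N - g *+ k = - z.
    by rewrite /z mulrnBl mulrnBr // opprD opprB addrCA addrA.
  have := nat_span_ge0 LQ gpk; rewrite zE => -[/eqP|Qz'].
    by rewrite oppr_eq0 => /eqP <-.
  by rewrite -(subrr z); apply: QD.
move=> q /gen[N N0 [k qk]]; exists (N * j)%N; first by rewrite muln_gt0 N0.
rewrite mulrnA -[q *+ N](subrK (g *+ k)) mulrnDl -(mulrnA g) mulnC mulrnA.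
by apply: nat_spanD; apply: nat_spanMn.
Qed.

(** Of two generators the larger one can be dropped, so a minimal generating list
    has a single element. *)
Lemma generated_cone_commensurable L :
    (forall a, a = 0 \/ Q a \/ Q (- a)) ->
    (forall g, g \in L -> Q g) -> generates_cone L ->
  forall x y, Q x -> Q y ->
  exists m n, [/\ (0 < m)%N, (0 < n)%N & x *+ m = y *+ n].
Proof.
move=> totQ; have [s sL] := ubnP (size L); elim: s L sL => // s IH [|g [|p L]] sL LQ gen x y Qx Qy.
- have [N N0 xN] := gen _ Qx; exfalso; apply: Q0.
  by rewrite -[X in Q X]xN; apply: QX.
- have Qg : Q g by apply: LQ; rewrite mem_head.
  have ray z : Q z -> exists m n, [/\ (0 < m)%N, (0 < n)%N & z *+ m = g *+ n].
    move=> Qz; have [N N0 [k /eqP]] := gen _ Qz; rewrite subr_eq0 => /eqP zN.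
    exists N, k; split=> //; case: k zN => // zN.
    by exfalso; apply: Q0; move: zN; rewrite mulr0n => <-; apply: QX.
  have [m [n [m0 n0 xm]]] := ray _ Qx; have [m' [n' [m0' n0' ym]]] := ray _ Qy.
  exists (m * n')%N, (m' * n)%N; rewrite !muln_gt0 m0 n0 m0' n0'; split=> //.
  by rewrite !mulrnA xm ym -!mulrnA mulnC.
- have memg : g \in g :: p :: L by rewrite mem_head.
  have memp : p \in g :: p :: L by rewrite in_cons mem_head orbT.
  have LQp h : h \in p :: L -> Q h by move=> hL; apply: LQ; rewrite in_cons hL orbT.
  have LQg h : h \in g :: L -> Q h.
    by rewrite in_cons => /orP[/eqP->|hL]; [apply: LQ | apply: LQp; rewrite in_cons hL orbT].
  have drop_g : g = p \/ Q (g - p) -> generates_cone (p :: L).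
    by move=> gp; apply: generates_cone_drop gen => //; apply: LQ.
  case: (totQ (g - p)) => [/eqP|[Qgp|Qpg]].
  + by rewrite subr_eq0 => /eqP gp; apply: (IH (p :: L)) => //; apply: drop_g; left.
  + by apply: (IH (p :: L)) => //; apply: drop_g; right.
  + apply: (IH (g :: L)) => //; apply: (@generates_cone_drop p) => //.
    * exact: LQ.
    * by right; rewrite -opprB.
    * by move=> q /gen[N N0 qN]; exists N => //; apply: nat_span_swap.
Qed.

End AbelianCones.

(** * Determined orders have rank at most one *)

(** If no multiple of a positive [p] lay in the span of [L] modulo [E], then
    [p^-1] together with [L] would generate a cone, and a total extension of it
    would be a second order in which [L] is positive. *)
Lemma determined_commensurable (G : groupType) (P : set G) L (E : set G) :
    locally_nilpotent G -> torsion_free G ->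
    total_cone P -> determined_by P L ->
    subgrp E -> convex P E -> (forall x g, E [~ x, g]) ->
  forall x y, P x -> ~ E x -> P y -> ~ E y ->
  exists m n, [/\ (0 < m)%N, (0 < n)%N & E (y ^- n * x ^+ m)].
Proof.
move=> nilG tfG totP [PL detP] gE cE ER; have [[P1 PM PJ] _] := totP.
have [E1 EM EV] := gE.
pose pi := quotient_map gE ER.
have piM x y : pi (x * y) = (pi x + pi y)%R by apply: quotient_mapM.
have pi0 x : pi x = 0%R <-> E x by apply: quotient_map_eq0.
have pi1 : pi 1 = 0%R by apply/pi0.
have piV x : pi x^-1 = (- pi x)%R.
  by apply/eqP; rewrite -addr_eq0 -piM mulVg pi1.
have piX x n : pi (x ^+ n) = (pi x *+ n)%R.
  by elim: n => [|n IH]; rewrite ?mulr0n // expgS piM IH mulrS.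
have piJ x g : pi (x ^ g) = pi x.
  by rewrite conjgE !piM piV addrC addrK.
pose Q : set (abelian_quotient gE ER) :=
  [set a | exists x, [/\ pi x = a, P x & ~ E x]].
have QE x : Q (pi x) -> P x /\ ~ E x.
  move=> [y [yx Py Ey]]; have Eyx : E (y^-1 * x).
    by apply/pi0; rewrite piM piV yx addNr.
  rewrite -(mulVKg y x); split; first exact: cE.
  by move=> /(subgrp_mulr gE Eyx).
have Q0 : ~ Q 0%R by rewrite -pi1 => /QE[].
have QD a b : Q a -> Q b -> Q (a + b)%R.
  move=> [x [<- Px Ex]] [y [<- Py Ey]]; exists (x * y); split; first exact: piM.
    exact: PM.
  by case: (convex_posM totP gE cE Px Ex Py).
have totQ a : (a = 0 \/ Q a \/ Q (- a))%R.
  have [x <-] := quotient_map_surj a; rewrite -/(pi x).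
  have [Ex|Ex] := pselect (E x); first by left; apply/pi0.
  right; have [Px|Px] := pselect (P x); [left | right]; first by exists x.
  exists x^-1; split; rewrite ?piV //; last by move=> /EV; rewrite invgK.
  by apply: (total_coneVP totP) => // x1; apply: Ex; rewrite x1.
(* Elements of [L] inside [E] are positive in every cone considered below. *)
pose M := [seq pi l | l <- L & ~~ `[< E l >]].
have MQ a : a \in M -> Q a.
  move=> /mapP[l]; rewrite mem_filter => /andP[/asboolPn El lL] ->.
  by exists l; split=> //; apply: PL.
have span_ge0 a : nat_span M a -> a = 0%R \/ Q a by apply: nat_span_ge0.
have gen : generates_cone Q M.
  move=> _ [p [<- Pp Ep]]; apply: contrapT => nogen.
  pose S : set G := [set x | ~ E x /\ (exists k, nat_span M (pi x + pi p *+ k)%R)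
                             \/ E x /\ P x].
  have coneS : cone S.
    split.
    - by case=> -[].
    - have mixed x y k : ~ E x -> E y -> nat_span M (pi x + pi p *+ k)%R ->
          S (x * y) /\ S (y * x).
        move=> Ex Ey xk; have /pi0 y0 := Ey.
        split; left; rewrite piM y0 ?add0r ?addr0; split; try by exists k.
          by move=> /(subgrp_mulr gE Ey).
        by move=> /(subgrp_mull gE Ey).
      move=> x y [[Ex [k xk]]|[Ex Px]] [[Ey [m ym]]|[Ey Py]].
      + have xykm : nat_span M (pi (x * y)%g + pi p *+ (k + m))%R.
          by rewrite piM mulrnDr addrACA; apply: nat_spanD.
        left; split; last by exists (k + m)%N.
        move=> /pi0 xy0; move: xykm; rewrite xy0 add0r => pkm.
        have [km0|km0] := posnP (k + m)%N; last by apply: nogen; exists (k + m)%N.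
        move/eqP: km0; rewrite addn_eq0 => /andP[/eqP k0 /eqP m0].
        move: xk ym; rewrite k0 m0 !mulr0n !addr0 => /span_ge0[/pi0//|Qx].
        move=> /span_ge0[/pi0//|Qy]; apply: Q0.
        by rewrite -xy0 piM; apply: QD.
      + by case: (mixed x y k).
      + by case: (mixed y x m).
      + by right; split; [apply: EM | apply: PM].
    - move=> x g; have EJ : E (x ^ g) <-> E x by rewrite -!pi0 piJ.
      by move=> [[Ex xk]|[Ex Px]]; [left | right]; rewrite ?piJ EJ; split=> //; apply: PJ.
  have [R SR totR] := total_cone_extension nilG tfG coneS.
  have RP : R = P.
    apply: detP => // l lL; apply: SR.
    have [El|El] := pselect (E l); first by right; split=> //; apply: PL.
    left; split=> //; exists 0%N; rewrite mulr0n addr0; apply: nat_span_mem.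
    by apply/mapP; exists l => //; rewrite mem_filter lL andbT; apply/asboolPn.
  have : P p^-1.
    rewrite -RP; apply: SR; left; split; first by move=> /EV; rewrite invgK.
    by exists 1%N; rewrite piV mulr1n addNr; apply: nat_span0.
  by move=> /(PM _ _ Pp); rewrite mulgV.
move=> x y Px Ex Py Ey.
have [||m [n [m0 n0 xy]]] :=
    generated_cone_commensurable Q0 QD totQ MQ gen (x := pi x) (y := pi y).
- by exists x.
- by exists y.
exists m, n; split=> //; apply/pi0.
by rewrite piM piV !piX xy addNr.
Qed.

Section Determined.
Variables (G : groupType) (P : set G) (L : seq G).
Hypotheses (nilG : locally_nilpotent G) (tfG : torsion_free G).
Hypotheses (totP : total_cone P) (detP : determined_by P L).

Let coneP : cone P. Proof. by case: totP. Qed.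
Let P1 : ~ P 1. Proof. by case: coneP. Qed.

Local Notation "x ⪯ y" := (cone_le P x y) (at level 70).
Local Notation infin := (infinitesimal P [set: G]).
Local Notation hull := (convex_hull P).

Let small : small_commutators P [set: G].
Proof. exact: locally_nilpotent_small_commutators. Qed.

Let ge1 l : l \in L -> 1 ⪯ l.
Proof. by case: detP => PL _ /PL Pl; rewrite cone_le1; right. Qed.

Let list_max (A : set G) l0 : l0 \in L -> A l0 ->
  exists2 g, g \in L & A g /\ forall l, l \in L -> A l -> l ⪯ g.
Proof.
elim: L l0 => // a s IH l0; rewrite in_cons.
have [noA|/existsNP[b /not_implyP[bs /contrapT Ab]]] :=
    pselect (forall b, b \in s -> ~ A b).
  case/orP => [/eqP-> Aa|/noA//]; exists a; first exact: mem_head.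
  by split=> // l; rewrite in_cons => /orP[/eqP-> _|/noA//]; left.
have [g gs [Ag gmax]] := IH b bs Ab => _ _.
have [Aa|Aa] := pselect (A a); last first.
  exists g; first by rewrite in_cons gs orbT.
  by split=> // l; rewrite in_cons => /orP[/eqP->|/gmax].
case: (total_le totP a g) => ag; [exists g | exists a].
- by rewrite in_cons gs orbT.
- by split=> // l; rewrite in_cons => /orP[/eqP->|/gmax].
- by rewrite mem_head.
- split=> // l; rewrite in_cons => /orP[/eqP-> _|/gmax lg /lg]; first by left.
  by move=> {}lg; apply: cone_le_trans ag.
Qed.

Let one_subgrp : normal_subgrp [set 1 : G].
Proof.
split; last by move=> _ g ->; apply: conj1g.
by split=> // [_ _ -> ->|_ ->] /=; rewrite ?mulg1 ?invg1.
Qed.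

Let one_convex : convex P [set 1].
Proof. by move=> x _ Px _ ->; rewrite mulg1. Qed.

Let full_subgrp : normal_subgrp [set: G]. Proof. by []. Qed.
Let full_convex : convex P [set: G]. Proof. by move=> x e _ /(_ I). Qed.

(** Otherwise some element of [L] would lie in [F] but not in the hull of the
    largest such element. *)
Let hull_max (F : set G) g : normal_subgrp F -> convex P F ->
    g \in L -> F g -> (forall l, l \in L -> F l -> l ⪯ g) ->
  hull g = F.
Proof.
move=> nF cF gL Fg gmax; have g1 := ge1 gL.
have nH := hull_subgrp totP small g1; have cH := hull_convex totP small g1.
have HF : hull g `<=` F by apply: hull_min => //; case: nF.
apply/seteqP; split=> // x Fx; apply: contrapT => Hx.
have [l lL [Fl Hl]] := determined_meets_sections totP detP nH cH nF cF HF Fx Hx.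
apply: Hl; apply: (convex_interval totP (proj1 nH) cH (ge1 lL) (gmax l lL Fl)).
exact: hull_self.
Qed.

(** Let [g] be the largest element of [L]. Its hull is the whole group, so the
    quotient by [infin g] is abelian, and of rank one by
    [determined_commensurable]. If [infin g] were nontrivial, it would be the
    hull of the largest element [h] of [L] inside it. Then [infin g] is central
    modulo [infin h]. As the quotient by [infin g] has rank one, the quotient by
    [infin h] is abelian too, hence of rank one by [determined_commensurable]; but
    [g] and [h] are not commensurable in it. *)
Theorem determined_rank_one :
  (forall x y : G, commute x y) /\
  forall x y, P x -> P y ->
    exists m n, [/\ (0 < m)%N, (0 < n)%N & x ^+ m = y ^+ n].
Proof.
have gt1 x : x <> 1 -> P x \/ P x^-1.
  by move=> x1; have [|/(total_coneVP totP x1)] := pselect (P x); [left|right].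
have [triv|/existsNP[x0 x01]] := pselect (forall x : G, x = 1).
  split; first by move=> x y; rewrite (triv x); apply/esym/commute1.
  by move=> x y; rewrite (triv x) => /P1.
have [l lL _] := determined_meets_sections totP detP one_subgrp one_convex
  full_subgrp full_convex (@subsetT _ _) I x01.
have [g gL [_ gmax]] := list_max (A := [set: G]) lL I.
have g1 := ge1 gL; have Pg : P g by case: detP => PL _; apply: PL.
have hullg : hull g = [set: G] by apply: hull_max.
have nG := infinitesimal_subgrp totP small g1.
have cG := infinitesimal_convex totP small g1.
have comm_g x y : infin g [~ x, y] by apply: hull_comm; rewrite ?hullg.
have commens_g := determined_commensurable nilG tfG totP detP (proj1 nG) cG comm_g.
have not_gg : ~ infin g g.
  by move=> /(infinitesimal_self totP g1) gE; apply: P1; rewrite -gE.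
have [trivg|/existsNP[a /not_implyP[ga a1]]] :=
    pselect (forall a, infin g a -> a = 1).
  split; first by move=> x y; apply/commgP/eqP/trivg.
  have Pg' x : P x -> ~ infin g x by move=> Px /trivg x1; apply: P1; rewrite -x1.
  move=> x y Px Py; have [m [n [m0 n0 /trivg /eqP]]] :=
    commens_g _ _ Px (Pg' _ Px) Py (Pg' _ Py).
  by rewrite mulg_eq1 eqg_inv => /eqP xy; exists m, n; split.
exfalso.
have one_g : [set 1] `<=` infin g by move=> _ ->; case: nG => -[].
have [l' l'L [gl' _]] := determined_meets_sections totP detP one_subgrp one_convex
  nG cG one_g ga a1.
have [h hL [gh hmax]] := list_max l'L gl'.
have h1 := ge1 hL; have Ph : P h by case: detP => PL _; apply: PL.
have hullh : hull h = infin g by apply: hull_max.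
have nH := infinitesimal_subgrp totP small h1.
have cH := infinitesimal_convex totP small h1.
have [[_ HM HV] HJ] := nH.
have comm_h_small x y : infin g x -> infin h [~ x, y].
  by rewrite -hullh; apply: hull_comm.
have comm_h_pos x y : P x -> P y -> infin h [~ x, y].
  move=> Px Py.
  have [gx|gx] := pselect (infin g x); first exact: comm_h_small.
  have [gy|gy] := pselect (infin g y).
    by rewrite -invgR; apply/HV/comm_h_small.
  have [m [n [m0 n0 d_g]]] := commens_g _ _ Px gx Py gy.
  have xmy : infin h [~ x ^+ m, y].
    rewrite -[x ^+ m](mulVKg (y ^+ n)); set d := y ^- n * x ^+ m in d_g *.
    suff -> : [~ y ^+ n * d, y] = [~ d, y] by apply: comm_h_small.
    rewrite !commgEl invgM conjMg conjXg (_ : y ^ y = y); last by gword.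
    by gword.
  case: (proj2 totP [~ x, y]) => xy1.
    apply: (convex_interval totP (proj1 nH) cH xy1 _ xmy).
    exact: commgX_ge.
  rewrite -[[~ x, y]]invgK; apply: (HV).
  apply: (convex_interval totP (proj1 nH) cH _ _ (HV _ xmy)).
    exact: cone_le1V.
  by apply: cone_leV => //; apply: commgX_le.
have comm_h x y : infin h [~ x, y].
  have posl x' y' : P x' -> infin h [~ x', y'].
    move=> Px; have [->|/gt1[Py|Py]] := pselect (y' = 1).
    - by rewrite commg1; case: nH => -[].
    - exact: comm_h_pos.
    - have -> : [~ x', y'] = [~ x', y'^-1]^-1 ^ y' by gword.
      by apply/HJ/HV/comm_h_pos.
  have [->|/gt1[Px|Px]] := pselect (x = 1).
  - by rewrite comm1g; case: nH => -[].
  - exact: posl.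
  - have -> : [~ x, y] = [~ x^-1, y]^-1 ^ x by gword.
    by apply/HJ/HV/posl.
have sub_hg : infin h `<=` infin g.
  by move=> b [_ /(_ 1%N) [b1 b2]]; rewrite -hullh; exists 1%N.
have not_hg : ~ infin h g by move=> /sub_hg.
have not_hh : ~ infin h h.
  by move=> /(infinitesimal_self totP h1) hE; apply: P1; rewrite -hE.
have [m [n [m0 n0 /sub_hg]]] :=
  determined_commensurable nilG tfG totP detP (proj1 nH) cH comm_h Pg not_hg Ph not_hh.
have ghn : infin g (h ^- n).
  have [[_ _ GV] _] := nG.
  by apply: GV; apply: (subgrpX (proj1 nG)).
move=> /(subgrp_mull (proj1 nG) ghn) /(convex_root totP (proj1 nG) cG m0).
exact: not_gg.
Qed.

End Determined.

(** * Rank *)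

Section Rank.
Variable A : zmodType.
Local Open Scope ring_scope.

(** Every pure tensor is a rational multiple of the tensor of [a] and [1]; the
    dimension is [0] if the latter vanishes and [1] otherwise. *)
Lemma rank_le1_commensurable (a : A) :
    (forall b, exists m n, (0 < m)%N /\ (b *+ m = a *+ n \/ - b *+ m = a *+ n)) ->
  rank_le A 1.
Proof.
move=> comm; set t := pure_tensor a (1 : rat).
have pureMn b (q : rat) n : pure_tensor b q *+ n = pure_tensor (b *+ n) q.
  elim: n => [|n IH]; last by rewrite !mulrS IH -pure_tensorDl.
  by apply: (@addIr _ (pure_tensor 0 q)); rewrite -pure_tensorDl !add0r.
have pureN b (q : rat) : - pure_tensor b q = pure_tensor (- b) q.
  apply/eqP; rewrite eq_sym -addr_eq0 -pure_tensorDl addNr.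
  by rewrite -(mulr0n 0) -pureMn mulr0n.
have span (v : tensor A rat) : exists c : rat, v = c *: t.
  elim/tensor_ind: v => [|u v [c ->] [d ->]|b q].
  - by exists 0; rewrite scale0r.
  - by exists (c - d); rewrite scalerBl.
  have [m [n [m0 bm]]] := comm b; have m0q : m%:R != 0 :> rat by rewrite pnatr_eq0 -lt0n.
  have qE : q = m%:R * (q / m%:R) by rewrite mulrC divfK.
  have bq : pure_tensor b q = pure_tensor b (q / m%:R) *+ m.
    by rewrite {1}qE -(scale_pure_tensor m%:R) scaler_nat.
  have tE (r : rat) : pure_tensor (a *+ n) r = (n%:R * r) *: t.
    by rewrite -pureMn /t scale_pure_tensor mulr1 -scale_pure_tensor scaler_nat.
  rewrite bq; case: bm => bm; first by rewrite pureMn bm tE; eexists.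
  exists (- (n%:R * (q / m%:R))); rewrite scaleNr -tE -bm -pureMn -pureN.
  by rewrite mulNrn opprK.
have [t0|t0] := pselect (t = 0).
  exists 0%N => //; exists (fun=> 0); split; first by move=> c _ [].
  by move=> v; have [c ->] := span v; exists (fun=> 0); rewrite big_ord0 t0 scaler0.
exists 1%N => //; exists (fun=> t); split.
  move=> c; rewrite big_ord1 => /eqP; rewrite scaler_eq0 => /orP[/eqP c0|/eqP//] i.
  by rewrite (ord1 i).
by move=> v; have [c ->] := span v; exists (fun=> c); rewrite big_ord1.
Qed.

End Rank.

Lemma zmod_ofX (G : groupType) (abG : abelian_group G) (x : G) n :
  ((x : zmod_of abG) *+ n)%R = x ^+ n.
Proof. by elim: n => // n IH; rewrite expgS mulrS IH. Qed.

Theorem total_cone_not_isolated (G : groupType) (P : set G) (L : seq G) :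
    locally_nilpotent G -> torsion_free G ->
    ~ (exists abG : abelian_group G, rank_le (zmod_of abG) 1) ->
    total_cone P -> (forall l, l \in L -> P l) ->
  exists Q, [/\ total_cone Q, forall l, l \in L -> Q l & Q <> P].
Proof.
move=> nilG tfG rkG totP PL; apply: contrapT => noQ; apply: rkG.
have detP : determined_by P L.
  by split=> // Q totQ QL; apply: contrapT => QP; apply: noQ; exists Q.
have [abG comm] := determined_rank_one nilG tfG totP detP.
exists abG.
have [[a Pa]|noP] := pselect (exists a, P a); last first.
  apply: (@rank_le1_commensurable _ (0%R)) => b; exists 1%N, 1%N; split=> //; left.
  have [->//|b1] := pselect (b = 0%R); exfalso; apply: noP.
  have [Pb|/(total_coneVP totP b1) Pb] := pselect (P b); by eexists; eassumption.
apply: (@rank_le1_commensurable _ (a : zmod_of abG)) => b.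
have [->|b1] := pselect (b = 0%R).
  by exists 1%N, 0%N; split=> //; left; rewrite mulr0n mul0rn.
have [Pb|/(total_coneVP totP b1) Pb] := pselect (P b).
  have [m [n [m0 _ bm]]] := comm _ _ Pb Pa; exists m, n; split=> //; left.
  by rewrite !zmod_ofX.
have [m [n [m0 _ bm]]] := comm _ _ Pb Pa; exists m, n; split=> //; right.
by rewrite (zmod_ofX abG a); rewrite -bm -(zmod_ofX abG).
Qed.

(** * A characterization of the Cantor space *)

Section CantorCharacterization.
Variables (T : ptopologicalType) (U : nat -> set T).
Hypothesis compT : compact [set: T].
Hypothesis clopenU : forall n, clopen (U n).
Hypothesis sepU : forall x y, x <> y -> exists n, U n x /\ ~ U n y.
Hypothesis perfT : forall V : set T, open V -> V !=set0 ->
  exists x y, [/\ V x, V y & x <> y].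

Let hausT : hausdorff_space T.
Proof.
rewrite open_hausdorff => x y /eqP /sepU[n [Ux Uy]]; exists (U n, ~` U n).
  by split; apply/mem_set.
have [oU cU] := clopenU n; split=> //; first exact: closed_openC.
by rewrite setICr.
Qed.

Let splitter (V : set T) :
  exists n, open V -> V !=set0 -> V `&` U n !=set0 /\ V `&` ~` U n !=set0.
Proof.
have [oV|] := pselect (open V); last by exists 0%N.
have [V0|] := pselect (V !=set0); last by exists 0%N.
have [x [y [Vx Vy /sepU[n [Ux Uy]]]]] := perfT oV V0.
by exists n => _ _; split; [exists x | exists y].
Qed.

(** Cutting by [U n] at stage [n] separates the points that [U n] separates;
    where [U n] does not cut, another [U m] is used to keep both pieces
    nonempty. *)
Let cut n (V : set T) : set T :=
  if pselect (V `&` U n !=set0 /\ V `&` ~` U n !=set0) then U n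
  else U (projT1 (cid (splitter V))).

Let refine n (V : set T) (b : bool) : set T :=
  (if b then cut n V else ~` cut n V) `&` V.

Let cut_clopen n V : clopen (cut n V).
Proof. by rewrite /cut; case: pselect => ?; apply: clopenU. Qed.

Let cut_splits n V : open V -> V !=set0 ->
  V `&` cut n V !=set0 /\ V `&` ~` cut n V !=set0.
Proof.
rewrite /cut; case: pselect => // ? oV V0.
exact: projT2 (cid (splitter V)) oV V0.
Qed.

Lemma cantor_homeomorphic : homeomorphic T cantor_space.
Proof.
have [||||||f [fcont fsurj finj]] := @tree_map_props (fun=> bool) T refine
  (fun V => clopen V /\ V !=set0) compT hausT.
- move=> n V; apply/seteqP; split=> [t Vt|t [b _ []//]].
  by have [cVt|cVt] := pselect (cut n V t); [exists true | exists false].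
- move=> n V b [clV V0]; split.
    by apply: clopenI => //; case: b => //; apply: clopenC.
  have [[x [Vx cx]] [y [Vy cy]]] := cut_splits n (proj1 clV) V0.
  by case: b; [exists x | exists y].
- by move=> V [].
- by split; [exact: clopenT | exists point].
- by move=> V [[]].
- move=> x y /eqP /sepU[n [Ux Uy]]; exists n => V b.
  move=> [cx Vx] [cy Vy]; move: cx cy; rewrite /cut; case: pselect => [?|].
    by case: b.
  by case; split; [exists x | exists y].
have {}finj : injective f.
  move=> x y; apply: finj; rewrite ?in_setT //.
  move=> n V i j _ _ [z [[iz _] [jz _]]].
  by case: i j iz jz => -[].
have f_onto : forall x, exists b, f b = x.
  by move=> x; have [b _ bx] := fsurj x I; exists b.
pose g (x : T) : cantor_space := projT1 (cid (f_onto x)).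
have gK : cancel g f by move=> x; apply: projT2 (cid (f_onto x)).
have fK : cancel f g by move=> b; apply: finj; rewrite gK.
exists g, f; split=> //; apply/continuous_closedP => C clC.
have -> : g @^-1` C = f @` C.
  apply/seteqP; split=> [x Cgx|_ [b Cb <-]] /=; first by exists (g x).
  by rewrite fK.
apply: compact_closed => //; apply: continuous_compact.
  exact: continuous_subspaceT.
exact: (subclosed_compact clC cantor_space_compact).
Qed.

End CantorCharacterization.

(** * The space of bi-orders *)

Section BiOrders.
Variable G : groupType.

Lemma left_order_nbhs (P : left_order G) (U : set (left_order G)) :
    nbhs P U ->
  exists L : seq (G * G), (forall z, z \in L -> P z.1 z.2) /\
    forall Q : left_order G, (forall z, z \in L -> Q z.1 z.2) -> U Q.
Proof.
rewrite nbhsE => -[V [[D subD <-] [B DB BP]] VU].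
have [F subF FE] := subD _ DB.
suff [L [LP LB]] : exists L : seq (G * G), (forall z, z \in L -> P z.1 z.2) /\
    forall Q : left_order G, (forall z, z \in L -> Q z.1 z.2) ->
    forall S : set (left_order G), S \in finmap.enum_fset F -> S Q.
  by exists L; split=> // Q /LB LQ; apply: VU; exists B => //; rewrite -FE.
have sub S : S \in finmap.enum_fset F -> lo_subbase S /\ S P.
  move=> SF; split; first by apply/set_mem/subF.
  by move: BP; rewrite -FE; apply.
elim: (finmap.enum_fset F) sub => [|S s IH] sub; first by exists [::].
have [[x [y SE]] SP] := sub _ (mem_head _ _).
have [S' S's|L [LP LB]] := IH; first by apply: sub; rewrite in_cons S's orbT.
exists ((x, y) :: L); split.
  by move=> z; rewrite in_cons => /orP[/eqP->|/LP//] /=; move: SP; rewrite SE.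
move=> Q LQ S'; rewrite in_cons => /orP[/eqP->|].
  by rewrite SE; apply: (LQ (x, y)); rewrite mem_head.
by apply: LB => z zL; apply: LQ; rewrite in_cons zL orbT.
Qed.

Lemma left_order_open (x y : G) : open [set P : left_order G | P x y].
Proof.
exists [set [set P : left_order G | P x y]]; last by rewrite bigcup_set1.
move=> _ ->; by apply: (@finI_from1 _ _ _ id); exists x, y.
Qed.

Lemma biorder_open (x y : G) : open [set P : BiO G | \val P x y].
Proof. by exists [set P : left_order G | P x y] => //; apply: left_order_open. Qed.

Lemma biorder_ltE (P : BiO G) x y : \val P x y <-> \val P 1 (x^-1 * y).
Proof.
by split=> /(lo_left _); [move=> /(_ x^-1) | move=> /(_ x)];
  rewrite ?mulVg ?mulg1 ?mulVKg.
Qed.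

Definition positive_cone (P : BiO G) : set G := [set x | \val P 1 x].

Lemma positive_cone_total (P : BiO G) : total_cone (positive_cone P).
Proof.
have bi : BiO G (\val P) by apply: set_mem (valP P).
split; first split.
- exact: lo_irr.
- move=> x y Px Py; apply: (lo_trans Px).
  by have := lo_left x Py; rewrite mulg1.
- move=> x g /(bi _ _ g) /(lo_left g^-1).
  by rewrite mul1g mulVg.
move=> x; have [->|x1] := pselect (x = 1); first by left; left.
case: (lo_total (\val P) x1) => Px; last by left; rewrite cone_le1; right.
right; right; have := lo_left x^-1 Px.
by rewrite mulVg /positive_cone /= mulg1.
Qed.

Section OfCone.
Variables (C : set G) (totC : total_cone C).

Let lt (x y : G) : Prop := C (x^-1 * y).

Let lt_irr x : ~ lt x x.
Proof. by rewrite /lt mulVg; case: totC => -[]. Qed.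

Let lt_trans x y z : lt x y -> lt y z -> lt x z.
Proof. by case: totC => -[_ CM _] _ /CM /[apply]; rewrite /lt; gword. Qed.

Let lt_total x y : x <> y -> lt x y \/ lt y x.
Proof.
move=> xy; have [Cxy|Cxy] := pselect (C (x^-1 * y)); [by left | right].
rewrite /lt -[x in _ * x]invgK -invgM; apply: total_coneVP => //.
by move=> /eqP; rewrite mulg_eq1 => /eqP/invg_inj.
Qed.

Let lt_left x y g : lt x y -> lt (g * x) (g * y).
Proof. by rewrite /lt; gword. Qed.

Let lt_order : left_order G := LeftOrder lt_irr lt_trans lt_total lt_left.

Let lt_bi : BiO G lt_order.
Proof.
move=> x y g /=; rewrite /lt => Cxy; have [[_ _ CJ] _] := totC.
by have := CJ _ g Cxy; gword.
Qed.

Definition biorder_of_cone : BiO G := exist _ lt_order (mem_set lt_bi).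

Lemma positive_coneK : positive_cone biorder_of_cone = C.
Proof.
by apply/seteqP; split=> x; rewrite /positive_cone /= /lt invg1 mul1g.
Qed.

End OfCone.

Lemma positive_cone_inj : injective positive_cone.
Proof.
move=> P Q PQ; apply: val_inj.
have : (\val P : G -> G -> Prop) = \val Q.
  apply/funext => x; apply/funext => y; apply/propext.
  rewrite (biorder_ltE P) (biorder_ltE Q).
  by have := congr1 (fun C : set G => C (x^-1 * y)) PQ; rewrite /positive_cone /= => ->.
case: (\val P) (\val Q) => [lt1 a1 b1 c1 d1] [lt2 a2 b2 c2 d2] /= E.
by case: _ / E a2 b2 c2 d2 => a2 b2 c2 d2; congr LeftOrder; apply: Prop_irrelevance.
Qed.

Lemma biorder_nbhs (P : BiO G) (U : set (BiO G)) :
    nbhs P U ->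
  exists L : seq G, (forall l, l \in L -> positive_cone P l) /\
    forall Q : BiO G, (forall l, l \in L -> positive_cone Q l) -> U Q.
Proof.
rewrite nbhsE => -[_ [[W oW <-] WP] WU].
have [L [LP LW]] := left_order_nbhs (open_nbhs_nbhs (conj oW WP)).
exists [seq z.1^-1 * z.2 | z <- L]; split.
  by move=> _ /mapP[z zL ->]; apply: (iffLR (biorder_ltE _ _ _)); apply: LP.
move=> Q LQ; apply: WU; apply: LW => z zL.
apply: (iffRL (biorder_ltE _ _ _)); apply: LQ.
exact: map_f.
Qed.

Lemma biorder_clopen (x : G) : clopen [set P : BiO G | positive_cone P x].
Proof.
split; first exact: biorder_open.
rewrite -openC; have [->|x1] := pselect (x = 1).
  rewrite (_ : ~` _ = setT); first exact: openT.
  by apply/seteqP; split=> // P _ /=; apply: lo_irr.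
rewrite (_ : ~` _ = [set P : BiO G | \val P x 1]); first exact: biorder_open.
apply/seteqP; split=> P /=; last first.
  by move=> Px /(lo_trans Px); apply: lo_irr.
by move=> nPx; case: (lo_total (\val P) x1).
Qed.

(** Along an ultrafilter each comparison is eventually decided; the decisions
    form a bi-order, which is the limit. *)
Lemma biorder_compact : compact [set: BiO G].
Proof.
rewrite compact_ultra => F UF _.
pose C : set G := [set x | F [set P | positive_cone P x]].
have ev (A B : set (BiO G)) : A `<=` B -> F A -> F B by apply: filterS.
have totC : total_cone C.
  split; first split.
  - move=> F1; apply: (@filter_not_empty _ F); apply: ev F1.
    by move=> P /(lo_irr (x := 1)).
  - move=> x y Fx Fy; apply: (ev _ _ _ (filterI Fx Fy)) => P [Px Py].
    by have [[_ PM _] _] := positive_cone_total P; apply: PM.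
  - move=> x g; apply: ev => P Px.
    by have [[_ _ PJ] _] := positive_cone_total P; apply: PJ.
  - move=> x; have [->|x1] := pselect (x = 1); first by left; left.
    have [Fx|Fx] := in_ultra_setVsetC [set P | positive_cone P x] UF.
      by left; rewrite cone_le1; right.
    right; right; rewrite mulg1; apply: ev Fx => P Px.
    exact: (total_coneVP (positive_cone_total P)).
exists (biorder_of_cone totC); split=> // U /biorder_nbhs[L [LP LU]].
have {}LP l : l \in L -> F [set P | positive_cone P l].
  by move=> /LP; rewrite positive_coneK.
suff FL : F [set Q | forall l, l \in L -> positive_cone Q l] by apply: ev FL.
elim: L LP {LU} => [|l L IH] LP.
  by apply: (ev setT) => //; apply: filterT.
have FL : F [set Q | forall l, l \in L -> positive_cone Q l].
  by apply: IH => a aL; apply: LP; rewrite in_cons aL orbT.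
apply: (ev _ _ _ (filterI (LP l (mem_head _ _)) FL)) => Q [Ql QL] a.
by rewrite in_cons => /orP[/eqP->|/QL].
Qed.

End BiOrders.

Theorem corollary3p3 (G : groupType)
    (nilG : locally_nilpotent G)
    (rkG : ~ exists abG : abelian_group G, rank_le (zmod_of abG) 1)
    (cntG : countable [set: G])
    (tfG : torsion_free G) :
  homeomorphic (BiO G) cantor_space.
Proof.
have [C0 _ totC0] : exists2 C : set G, set0 `<=` C & total_cone C.
  by apply: total_cone_extension => //; split.
pose T : ptopologicalType := HB.pack (BiO G : Type)
  (Topological.on (BiO G)) (isPointed.Build (BiO G) (biorder_of_cone totC0)).
have /countable_injP[c cinj] := cntG.
(* Two distinct orders disagree on the sign of some element, so the sets of
   orders making [e n] positive separate points once [e] enumerates [G]. *)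
have [e eK] : exists e : nat -> G, forall x, e (c x) = x.
  pose e n := xget 1 [set x | c x = n]; exists e => x.
  apply: cinj; rewrite ?in_setT // /e.
  by case: xgetP => [_ -> //|/(_ x)]; case.
apply: (@cantor_homeomorphic T (fun n => [set P : BiO G | positive_cone P (e n)])).
- exact: biorder_compact.
- by move=> n; apply: biorder_clopen.
- move=> P Q PQ; apply: contrapT => nosep.
  apply: PQ; apply: positive_cone_inj; apply/seteqP.
  have sub (C D : set G) : total_cone C -> total_cone D -> C `<=` D -> D `<=` C.
    move=> totC totD CD x Dx; apply: contrapT => /(total_coneVP totC) Cx.
    have [[D1 DM _] _] := totD; have x1 : x <> 1 by move=> x1; apply: D1; rewrite -x1.
    by apply: D1; have := DM _ _ Dx (CD _ (Cx x1)); rewrite mulgV.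
  have PQ x : positive_cone P x -> positive_cone Q x.
    by move=> Px; apply: contrapT => Qx; apply: nosep; exists (c x); rewrite /= eK.
  by split=> //; apply: sub => //; apply: positive_cone_total.
- move=> V oV [P VP].
  have /biorder_nbhs[L [LP LV]] : nbhs (P : BiO G) V by apply: open_nbhs_nbhs.
  have [C [totC CL CP]] :=
    total_cone_not_isolated nilG tfG rkG (positive_cone_total P) LP.
  exists P, (biorder_of_cone totC); split=> //.
    by apply: LV => l /CL; rewrite positive_coneK.
  by move=> PC; apply: CP; rewrite PC positive_coneK.
Qed.
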